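(* Riemann ZMC examples in $\mathbb{L}^3$ foliated by timelike circles (of non-constant radius) contained in parallel timelike planes corresponding to the case $\vec a=(1,1)$ are parametrized as $$X(r,v)=(x(r),m(r),m(r))+r(0,\cosh v,\sinh v),$$ where $\lambda>0$, $r>1/\sqrt\lambda$, $v\in\mathbb{R}$ and $$x(r)=\frac{1}{\sqrt\lambda}\operatorname{arcosh}(\sqrt\lambda\, r),\qquad m(r)=\frac{\sqrt\lambda\, r\sqrt{\lambda r^2-1}+\operatorname{arsinh}\left(\sqrt{\lambda r^2-1}\right)}{2\lambda^{3/2}}.$$ The surface is contained in the halfspace $x_1>0$ and converges to a hyperbola as $x_1\to0$.
   Context: $\mathbb{L}^3$ is $\mathbb{R}^3$ with the metric $\langle,\rangle=dx_1^2+dx_2^2-dx_3^2$. The mean curvature $H$ is defined where the induced metric is non-degenerate; ZMC means $H=0$ there. A timelike circle in a plane $x_1=\text{const}$ is a hyperbola $s\mapsto p+r(0,\cosh s,\sinh s)$, $r>0$. A Riemann ZMC example is a non-rotational surface with zero mean curvature foliated by (pieces of) circles contained in parallel planes. The surfaces ''corresponding to $\vec a=(1,1)$'' are those of the form $X(q,v)=(x(q),m(q)\vec a)+\sqrt q(0,\cosh v,\sinh v)$ with $q=r^2$, $\vec a=(1,1)$ in the $x_2x_3$-plane, $x(q)=\frac12\int^q\frac{du}{\sqrt{\lambda u^2-u}}$, $m(q)=\frac12\int^q\frac{u\,du}{\sqrt{\lambda u^2-u}}$ (integrals up to additive constants), $\lambda\in\mathbb{R}$, with positive radicand and $q>0$.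 *)

(* Defs.v *)
From Stdlib Require Import Reals.
From Coquelicot Require Import Coquelicot.
Open Scope R_scope.

(** * Lorentz-Minkowski space L^3 *)

Definition pt : Type := (R * R * R)%type.

Definition x1 (p : pt) : R := fst (fst p).
Definition x2 (p : pt) : R := snd (fst p).
Definition x3 (p : pt) : R := snd p.

Definition padd (p q : pt) : pt := (x1 p + x1 q, x2 p + x2 q, x3 p + x3 q).
Definition psub (p q : pt) : pt := (x1 p - x1 q, x2 p - x2 q, x3 p - x3 q).
Definition pscal (k : R) (p : pt) : pt := (k * x1 p, k * x2 p, k * x3 p).

Definition lorentz (p q : pt) : R := x1 p * x1 q + x2 p * x2 q - x3 p * x3 q.

(* The vector with [lorentz (lcross p q) w = det (p, q, w)] for all [w]. *)
Definition lcross (p q : pt) : pt :=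
  (x2 p * x3 q - x3 p * x2 q,
   x3 p * x1 q - x1 p * x3 q,
   - (x1 p * x2 q - x2 p * x1 q)).

(** * Parametrized surfaces

    A surface is given by a parameter domain [D] and a map [X]; the values of
    [X] outside [D] are irrelevant. *)

Definition d1 (f : R -> R -> R) (u v : R) : R := Derive (fun t => f t v) u.
Definition d2 (f : R -> R -> R) (u v : R) : R := Derive (fun t => f u t) v.

Fixpoint of_class_C (k : nat) (D : R -> R -> Prop) (f : R -> R -> R) : Prop :=
  match k with
  | O => forall u v, D u v ->
           continuous (fun w : R * R => f (fst w) (snd w)) (u, v)
  | S k' =>
      (forall u v, D u v ->
         ex_derive (fun t => f t v) u /\ ex_derive (fun t => f u t) v) /\
      of_class_C k' D (d1 f) /\ of_class_C k' D (d2 f)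
  end.

Definition smooth (D : R -> R -> Prop) (f : R -> R -> R) : Prop :=
  forall k, of_class_C k D f.

Definition pd1 (X : R -> R -> pt) (u v : R) : pt :=
  (d1 (fun s t => x1 (X s t)) u v,
   d1 (fun s t => x2 (X s t)) u v,
   d1 (fun s t => x3 (X s t)) u v).
Definition pd2 (X : R -> R -> pt) (u v : R) : pt :=
  (d2 (fun s t => x1 (X s t)) u v,
   d2 (fun s t => x2 (X s t)) u v,
   d2 (fun s t => x3 (X s t)) u v).

Definition regular_surface (D : R -> R -> Prop) (X : R -> R -> pt) : Prop :=
  (exists u v, D u v) /\
  open (fun w : R * R => D (fst w) (snd w)) /\
  smooth D (fun u v => x1 (X u v)) /\
  smooth D (fun u v => x2 (X u v)) /\
  smooth D (fun u v => x3 (X u v)) /\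
  (* the two partial derivatives are linearly independent *)
  (forall u v, D u v -> lcross (pd1 X u v) (pd2 X u v) <> (0, 0, 0)).

Definition trace (D : R -> R -> Prop) (X : R -> R -> pt) : pt -> Prop :=
  fun p => exists u v, D u v /\ p = X u v.

(** * Mean curvature *)

Definition ffE (X : R -> R -> pt) u v := lorentz (pd1 X u v) (pd1 X u v).
Definition ffF (X : R -> R -> pt) u v := lorentz (pd1 X u v) (pd2 X u v).
Definition ffG (X : R -> R -> pt) u v := lorentz (pd2 X u v) (pd2 X u v).

Definition ffW (X : R -> R -> pt) u v := ffE X u v * ffG X u v - ffF X u v ^ 2.

(* Since [lorentz] of [lcross (pd1 X) (pd2 X)] with itself is [- ffW X], this
   is a unit vector (spacelike or timelike) wherever [ffW X u v <> 0]. *)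
Definition unit_normal (X : R -> R -> pt) u v : pt :=
  pscal (/ sqrt (Rabs (ffW X u v))) (lcross (pd1 X u v) (pd2 X u v)).

Definition sfe (X : R -> R -> pt) u v :=
  lorentz (unit_normal X u v) (pd1 (pd1 X) u v).
Definition sff (X : R -> R -> pt) u v :=
  lorentz (unit_normal X u v) (pd2 (pd1 X) u v).
Definition sfg (X : R -> R -> pt) u v :=
  lorentz (unit_normal X u v) (pd2 (pd2 X) u v).

(* The leading factor [<N, N>] is -1 on spacelike and 1 on timelike points. *)
Definition mean_curvature (X : R -> R -> pt) u v : R :=
  lorentz (unit_normal X u v) (unit_normal X u v) / 2 *
  ((sfe X u v * ffG X u v - 2 * sff X u v * ffF X u v + sfg X u v * ffE X u v)
   / ffW X u v).

Definition ZMC (D : R -> R -> Prop) (X : R -> R -> pt) : Prop :=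
  forall u v, D u v -> ffW X u v <> 0 -> mean_curvature X u v = 0.

(** * Rotational surfaces *)

Definition isometry (Phi : pt -> pt) : Prop :=
  forall p q,
    lorentz (psub (Phi p) (Phi q)) (psub (Phi p) (Phi q)) =
    lorentz (psub p q) (psub p q).

(* Up to conjugation by an isometry, the one-parameter groups of rotations of
   L^3, i.e. of isometries fixing a line pointwise, are these three: the axis
   is the x_3-axis (timelike), the x_1-axis (spacelike), or the line spanned by
   (0, 1, 1) (lightlike). *)
Definition rot_timelike_axis (t : R) (p : pt) : pt :=
  (cos t * x1 p - sin t * x2 p, sin t * x1 p + cos t * x2 p, x3 p).
Definition rot_spacelike_axis (t : R) (p : pt) : pt :=
  (x1 p, cosh t * x2 p + sinh t * x3 p, sinh t * x2 p + cosh t * x3 p).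
Definition rot_lightlike_axis (t : R) (p : pt) : pt :=
  (x1 p + t * (x2 p - x3 p),
   x2 p - t * x1 p - t ^ 2 / 2 * (x2 p - x3 p),
   x3 p - t * x1 p - t ^ 2 / 2 * (x2 p - x3 p)).

(* Invariance is only required for small times, so that open pieces of a
   surface of revolution also count as rotational. *)
Definition locally_invariant (rot : R -> pt -> pt) (S : pt -> Prop) : Prop :=
  forall p, S p ->
    exists eps, 0 < eps /\ forall t, Rabs t < eps -> S (rot t p).

Definition rotational (S : pt -> Prop) : Prop :=
  exists Phi rot,
    isometry Phi /\
    (rot = rot_timelike_axis \/ rot = rot_spacelike_axis \/
     rot = rot_lightlike_axis) /\
    locally_invariant rot (fun p => S (Phi p)).

(** * Riemann ZMC examples foliated by timelike circles *)

(* The point of parameter [s] on the timelike circle of center [p] and radius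
   [r] in the plane of equation [x_1 = x1 p]. *)
Definition circle_pt (p : pt) (r s : R) : pt :=
  padd p (pscal r (0, cosh s, sinh s)).

Definition timelike_circle (p : pt) (r : R) : pt -> Prop :=
  fun q => exists s, q = circle_pt p r s.

(* Each parameter curve [u = const] lies on a timelike circle, of center [c u]
   and radius [rho u], in the plane [x_1 = x1 (c u)]. *)
Definition foliated_by_timelike_circles
    (D : R -> R -> Prop) (X : R -> R -> pt) (c : R -> pt) (rho : R -> R) : Prop :=
  forall u v, D u v -> 0 < rho u /\ timelike_circle (c u) (rho u) (X u v).

Definition nonconstant_radius (D : R -> R -> Prop) (rho : R -> R) : Prop :=
  exists u v u' v', D u v /\ D u' v' /\ rho u <> rho u'.

Definition riemann_ZMC_timelike (D : R -> R -> Prop) (X : R -> R -> pt) : Prop :=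
  regular_surface D X /\
  ZMC D X /\
  ~ rotational (trace D X) /\
  exists c rho, foliated_by_timelike_circles D X c rho /\
                nonconstant_radius D rho.

(** * The case a = (1, 1) *)

Definition radicand (lam u : R) : R := lam * u ^ 2 - u.

Definition q_domain (lam q : R) : Prop := 0 < q /\ 0 < radicand lam q.

(* [F] is an indefinite integral of [f] on [J], i.e. determined up to an
   additive constant. *)
Definition indefinite_integral (f : R -> R) (J : R -> Prop) (F : R -> R) : Prop :=
  forall a b, J a -> J b -> is_RInt f a b (F b - F a).

Definition q_family (a : R * R) (x m : R -> R) (q v : R) : pt :=
  padd (x q, m q * fst a, m q * snd a) (pscal (sqrt q) (0, cosh v, sinh v)).

(* The surface is given in the parameter [r > 0], where [q = r ^ 2]. *)
Definition corresponds_to_1_1 (D : R -> R -> Prop) (X : R -> R -> pt) : Prop :=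
  exists (lam : R) (x m : R -> R),
    indefinite_integral (fun u => 1 / 2 * (1 / sqrt (radicand lam u)))
                        (q_domain lam) x /\
    indefinite_integral (fun u => 1 / 2 * (u / sqrt (radicand lam u)))
                        (q_domain lam) m /\
    (forall r v, D r v <-> 0 < r /\ q_domain lam (r ^ 2)) /\
    (forall r v, D r v -> X r v = q_family (1, 1) x m (r ^ 2) v).

(** * The explicit parametrization *)

Definition arcosh (y : R) : R := ln (y + sqrt (y ^ 2 - 1)).

Definition x_expl (lam r : R) : R := 1 / sqrt lam * arcosh (sqrt lam * r).

Definition m_expl (lam r : R) : R :=
  (sqrt lam * r * sqrt (lam * r ^ 2 - 1) + arcsinh (sqrt (lam * r ^ 2 - 1)))
  / (2 * Rpower lam (3 / 2)).

Definition X_expl (lam r v : R) : pt :=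
  padd (x_expl lam r, m_expl lam r, m_expl lam r)
       (pscal r (0, cosh v, sinh v)).

Definition D_expl (lam r v : R) : Prop := 1 / sqrt lam < r.

(** * Convergence as x_1 -> 0 *)

(* The sections of [S] by the planes [x_1 = t] converge to [C] as [t -> 0+], in
   the sense of Painleve and Kuratowski: [C] is both the lower limit and the
   upper limit of the sections. *)
Definition converges_as_x1_to_0 (S C : pt -> Prop) : Prop :=
  (forall p, C p -> forall eps : posreal,
     exists delta, 0 < delta /\
       forall t, 0 < t < delta -> exists q, S q /\ x1 q = t /\ ball p eps q) /\
  (forall p,
     (forall (eps : posreal) (delta : R), 0 < delta ->
        exists q, S q /\ 0 < x1 q < delta /\ ball p eps q) ->
     C p).

(* Main.v *)
Require Import Defs.
From Stdlib Require Import Reals Lra.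
From Coquelicot Require Import Coquelicot.
Open Scope R_scope.

(* With k = sqrt lam, w = sqrt (lam r^2 - 1) and u = arcosh (k r), one has
   x = u / k, w = sinh u, x' = 1 / w and m' = r^2 / w. Hence x and m are the
   required integrals, all partial derivatives are polynomials in a few smooth
   functions, and ZMC is an algebraic identity. Eliminating r and v by means of
   xi = x_2 - x_3 and eta = x_2 + x_3, the surface is the part x_1 > 0, xi > 0 of
     xi (eta - 2 M(x_1)) = R(x_1)^2,  where R(x) = cosh (k x) / k and M' = R^2,
   which makes sense up to x_1 = 0 and gives the limit hyperbola. If the surface
   were rotational, a nonzero Killing field p |-> (p - c) x n would be tangent to
   it; on each section x_1 = const tangency is a polynomial equation in xi, and
   its coefficients force n = 0. *)

(** * Hyperbolic functions *)

(** Two definitions shape the argument against rotational surfaces. [isometry] only says that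
    squared intervals are preserved, so an affine formula has to be proved before a conjugated
    rotation can be differentiated. [locally_invariant] allows a time bound that depends on the
    point; this still determines the derivative at t = 0 along each orbit, hence tangency of one and
    the same Killing field at every point. Of the cubic in xi, the leading coefficient gives n2 + n3
    = 0; the constant one, compared at two heights, gives n3 = n2 because R R' is increasing; the
    quadratic one then gives n1 = 0 because M is increasing. The translation by (c1, c2, c2) is the
    freedom left by the two indefinite integrals, the constant of m being multiplied by (1, 1). The
    sign of lam comes from the domain being nonempty: q > 0 and lam q^2 > q force lam > 0. *)

Lemma cosh2_sinh2 (v : R) : cosh v ^ 2 - sinh v ^ 2 = 1.
Proof.
assert (H : exp v * exp (- v) = 1) by (rewrite <- exp_plus, Rplus_opp_r; apply exp_0).
unfold cosh, sinh; nra.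
Qed.

Lemma cosh_minus_sinh (v : R) : cosh v - sinh v = exp (- v).
Proof. unfold cosh, sinh; lra. Qed.

Lemma cosh_plus_sinh (v : R) : cosh v + sinh v = exp v.
Proof. unfold cosh, sinh; lra. Qed.

Lemma cosh_pos (v : R) : 0 < cosh v.
Proof.
pose proof (exp_pos v); pose proof (exp_pos (- v)); unfold cosh; lra.
Qed.

Lemma sinh_pos (x : R) : 0 < x -> 0 < sinh x.
Proof.
intros Hx; unfold sinh; assert (exp (- x) < exp x); [apply exp_increasing|]; lra.
Qed.

Lemma one_lt_cosh (x : R) : 0 < x -> 1 < cosh x.
Proof.
intros Hx; pose proof (sinh_pos x Hx); pose proof (cosh2_sinh2 x);
  pose proof (cosh_pos x); nra.
Qed.

Lemma sinh_lt (x y : R) : x < y -> sinh x < sinh y.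
Proof.
intros H; unfold sinh; assert (exp (- y) < exp (- x)) by (apply exp_increasing; lra).
assert (exp x < exp y) by (apply exp_increasing; lra); lra.
Qed.

Lemma cosh_lt (x y : R) : 0 <= x -> x < y -> cosh x < cosh y.
Proof.
intros Hx Hxy; pose proof (sinh_lt x y Hxy).
assert (0 <= sinh x).
{ destruct Hx as [Hx | <-]; [pose proof (sinh_pos x Hx); lra | rewrite sinh_0; lra]. }
pose proof (cosh2_sinh2 x); pose proof (cosh2_sinh2 y).
pose proof (cosh_pos x); pose proof (cosh_pos y); nra.
Qed.

Lemma cosh_sinh_lt (x y : R) :
  0 < x -> x < y -> cosh x * sinh x < cosh y * sinh y.
Proof.
intros Hx Hxy; pose proof (sinh_lt x y Hxy); pose proof (cosh_lt x y ltac:(lra) Hxy).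
pose proof (cosh_pos x); pose proof (sinh_pos x Hx); nra.
Qed.

Lemma sqrt_cosh2_minus_1 (x : R) : 0 <= x -> sqrt (cosh x ^ 2 - 1) = sinh x.
Proof.
intros Hx; replace (cosh x ^ 2 - 1) with (sinh x ^ 2) by (pose proof (cosh2_sinh2 x); lra).
apply sqrt_pow2; destruct Hx as [Hx | <-]; [left; apply sinh_pos, Hx | rewrite sinh_0; lra].
Qed.

Lemma arcosh_cosh (x : R) : 0 <= x -> arcosh (cosh x) = x.
Proof.
intros Hx; unfold arcosh.
rewrite (sqrt_cosh2_minus_1 x Hx), cosh_plus_sinh; apply ln_exp.
Qed.

Lemma arcosh_pos (y : R) : 1 < y -> 0 < arcosh y.
Proof.
intros Hy; unfold arcosh; rewrite <- ln_1; apply ln_increasing; [lra|].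
pose proof (sqrt_pos (y ^ 2 - 1)); lra.
Qed.

Lemma cosh_arcosh (y : R) : 1 < y -> cosh (arcosh y) = y.
Proof.
intros Hy; unfold arcosh, cosh.
pose proof (sqrt_pos (y ^ 2 - 1)) as Hp.
assert (Hs : sqrt (y ^ 2 - 1) * sqrt (y ^ 2 - 1) = y ^ 2 - 1) by (apply sqrt_sqrt; nra).
set (w := sqrt (y ^ 2 - 1)) in *.
rewrite exp_Ropp, exp_ln by lra.
(* Conjugate factor: (y - w) (y + w) = y^2 - w^2 = 1. *)
replace (/ (y + w)) with (y - w); [lra|].
apply Rmult_eq_reg_r with (y + w); [rewrite Rinv_l; lra | lra].
Qed.

Lemma is_derive_arcosh (y : R) :
  1 < y -> is_derive arcosh y (/ sqrt (y ^ 2 - 1)).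
Proof.
intros Hy; assert (Hw : 0 < sqrt (y ^ 2 - 1)) by (apply sqrt_lt_R0; nra).
unfold arcosh; auto_derive.
- replace (y * (y * 1) + - (1)) with (y ^ 2 - 1) by ring; repeat split; [nra | lra].
- replace (y * (y * 1) + - (1)) with (y ^ 2 - 1) by ring.
  set (w := sqrt (y ^ 2 - 1)) in *; field; split; lra.
Qed.

Lemma is_derive_arcsinh (x : R) : is_derive arcsinh x (/ sqrt (x ^ 2 + 1)).
Proof. apply is_derive_Reals, derivable_pt_lim_arcsinh. Qed.

(** * The profile curve *)

Definition speed (lam r : R) : R := sqrt (lam * r ^ 2 - 1).

Lemma Rpower_3_2 (lam : R) : 0 < lam -> Rpower lam (3 / 2) = sqrt lam ^ 3.
Proof.
intros Hl; rewrite <- Rpower_sqrt, <- Rpower_pow, Rpower_mult by (try apply exp_pos; lra).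
f_equal; simpl; lra.
Qed.

Lemma D_expl_iff (lam r v : R) :
  0 < lam -> (D_expl lam r v <-> 1 < sqrt lam * r).
Proof.
intros Hl; pose proof (sqrt_lt_R0 lam Hl) as Hk; unfold D_expl; split; intros H.
- apply (Rmult_lt_compat_l (sqrt lam)) in H; [|lra].
  replace (sqrt lam * (1 / sqrt lam)) with 1 in H by (field; lra); lra.
- apply (Rmult_lt_reg_l (sqrt lam)); [lra|].
  replace (sqrt lam * (1 / sqrt lam)) with 1 by (field; lra); lra.
Qed.

Lemma D_expl_pos (lam r v : R) : 0 < lam -> D_expl lam r v -> 0 < r.
Proof.
intros Hl H; apply D_expl_iff in H; trivial.
pose proof (sqrt_lt_R0 lam Hl); nra.
Qed.

Lemma speed_alt (lam r : R) :
  0 < lam -> speed lam r = sqrt ((sqrt lam * r) ^ 2 - 1).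
Proof.
intros Hl; unfold speed; f_equal.
replace ((sqrt lam * r) ^ 2) with (sqrt lam * sqrt lam * r ^ 2) by ring.
rewrite sqrt_sqrt; lra.
Qed.

Lemma radicand_pos (lam r v : R) :
  0 < lam -> D_expl lam r v -> 0 < lam * r ^ 2 - 1.
Proof.
intros Hl H; apply D_expl_iff in H; trivial.
assert (Hk : sqrt lam * sqrt lam = lam) by (apply sqrt_sqrt; lra).
replace (lam * r ^ 2) with ((sqrt lam * r) * (sqrt lam * r))
  by (transitivity (sqrt lam * sqrt lam * r ^ 2); [ring | rewrite Hk; ring]).
nra.
Qed.

Lemma speed_pos (lam r v : R) : 0 < lam -> D_expl lam r v -> 0 < speed lam r.
Proof. intros Hl H; apply sqrt_lt_R0, (radicand_pos lam r v Hl H). Qed.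

Lemma speed_sqr (lam r v : R) :
  0 < lam -> D_expl lam r v -> speed lam r ^ 2 = lam * r ^ 2 - 1.
Proof.
intros Hl H; unfold speed; rewrite pow2_sqrt; trivial.
left; apply (radicand_pos lam r v Hl H).
Qed.

Lemma is_derive_x_expl (lam r v : R) :
  0 < lam -> D_expl lam r v -> is_derive (x_expl lam) r (/ speed lam r).
Proof.
intros Hl H; pose proof (speed_pos lam r v Hl H) as Hw.
pose proof (sqrt_lt_R0 lam Hl) as Hk.
rewrite (speed_alt lam r Hl) in *; apply D_expl_iff in H; trivial.
pose proof (is_derive_arcosh _ H) as Ha.
unfold x_expl; auto_derive.
- repeat split; eexists; exact Ha.
- change (fun x : R => arcosh x) with arcosh; rewrite (is_derive_unique _ _ _ Ha); field; lra.
Qed.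

Lemma is_derive_m_expl (lam r v : R) :
  0 < lam -> D_expl lam r v -> is_derive (m_expl lam) r (r ^ 2 / speed lam r).
Proof.
intros Hl H; pose proof (speed_pos lam r v Hl H) as Hw.
pose proof (sqrt_lt_R0 lam Hl) as Hk.
pose proof (sqrt_sqrt lam (Rlt_le _ _ Hl)) as Hkk.
pose proof (speed_sqr lam r v Hl H) as Hw2.
pose proof (radicand_pos lam r v Hl H) as Hr.
pose proof (D_expl_pos lam r v Hl H) as Hr0.
pose proof (is_derive_arcsinh (speed lam r)) as Ha.
(* Since w^2 + 1 = lam r^2 is the square of k r, the derivative of arcsinh at w is 1 / (k r). *)
replace (sqrt (speed lam r ^ 2 + 1)) with (sqrt lam * r) in Ha.
2:{ rewrite Hw2; replace (lam * r ^ 2 - 1 + 1) with ((sqrt lam * r) ^ 2).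
    - symmetry; apply sqrt_pow2; nra.
    - transitivity (sqrt lam * sqrt lam * r ^ 2); [ring | rewrite Hkk; ring]. }
unfold m_expl; rewrite (Rpower_3_2 lam Hl).
fold (speed lam r) in *.
auto_derive.
- replace (lam * (r * (r * 1)) + - (1)) with (lam * r ^ 2 - 1) by ring.
  repeat split; trivial; eexists; exact Ha.
- replace (lam * (r * (r * 1)) + - (1)) with (lam * r ^ 2 - 1) by ring.
  fold (speed lam r); change (fun x : R => arcsinh x) with arcsinh.
  rewrite (is_derive_unique _ _ _ Ha).
  set (w := speed lam r) in *; set (k := sqrt lam) in *.
  (* The factor clears the denominators 2 k^3 of m, w of the square root, and k r of arcsinh. *)
  apply Rmult_eq_reg_r with (2 * k ^ 4 * r * w);
    [|apply Rgt_not_eq; repeat apply Rmult_lt_0_compat; nra].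
  field_simplify; [|lra|lra].
  rewrite Hw2, <- Hkk. ring.
Qed.

(** * Isometries and rotations *)

(** A translation composed with an isometry is an isometry, so being rotational can be tested on the
    surface with c1 = c2 = 0. *)
Lemma rotational_trace_translate (c : pt) (S S' : pt -> Prop) :
  (forall p, S p <-> S' (psub p c)) -> rotational S -> rotational S'.
Proof.
intros HS [Phi [rot [HPhi [Hrot Hinv]]]].
exists (fun p => psub (Phi p) c), rot; split; [|split]; trivial.
- intros p q; rewrite <- (HPhi p q).
  unfold lorentz, psub, x1, x2, x3; simpl; ring.
- intros p Hp; apply HS, Hinv in Hp; destruct Hp as [eps [Heps Hp]].
  exists eps; split; trivial; intros t Ht; apply HS, Hp, Ht.
Qed.

Lemma pt_eq (p q : pt) : x1 p = x1 q -> x2 p = x2 q -> x3 p = x3 q -> p = q.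
Proof.
destruct p as [[a b] c], q as [[a' b'] c']; unfold x1, x2, x3; simpl; congruence.
Qed.

(** * Affine form of the isometries *)

Definition lin_comb (z e1 e2 e3 : pt) : pt :=
  padd (pscal (x1 z) e1) (padd (pscal (x2 z) e2) (pscal (x3 z) e3)).

Definition lorentz_basis (e1 e2 e3 : pt) : Prop :=
  lorentz e1 e1 = 1 /\ lorentz e2 e2 = 1 /\ lorentz e3 e3 = -1 /\
  lorentz e1 e2 = 0 /\ lorentz e1 e3 = 0 /\ lorentz e2 e3 = 0.

Ltac coords :=
  unfold lin_comb, padd, psub, pscal, lcross, lorentz, x1, x2, x3 in *; simpl in *.

Definition vol (u v w : pt) : R := lorentz (lcross u v) w.

(** The Gram determinant of three vectors is - vol^2, the sign being that of the metric; on an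
    orthonormal basis it is -1, so vol^2 = 1. *)
Lemma vol_lorentz_basis (e1 e2 e3 : pt) :
  lorentz_basis e1 e2 e3 -> vol e1 e2 e3 <> 0.
Proof.
intros (H1 & H2 & H3 & H4 & H5 & H6) H0.
assert (Hgram : vol e1 e2 e3 ^ 2 = -
  (lorentz e1 e1 * (lorentz e2 e2 * lorentz e3 e3 - lorentz e2 e3 ^ 2)
   - lorentz e1 e2 * (lorentz e1 e2 * lorentz e3 e3 - lorentz e2 e3 * lorentz e1 e3)
   + lorentz e1 e3 * (lorentz e1 e2 * lorentz e2 e3 - lorentz e2 e2 * lorentz e1 e3))).
{ unfold vol; coords; ring. }
rewrite H0, H1, H2, H3, H4, H5, H6 in Hgram; lra.
Qed.

(** Cramer's rule: divided by [vol], the three vector products form the basis dual to e1, e2, e3 for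
    the Lorentz product. *)
Lemma lorentz_nondegenerate (e1 e2 e3 d : pt) :
  vol e1 e2 e3 <> 0 ->
  lorentz d e1 = 0 -> lorentz d e2 = 0 -> lorentz d e3 = 0 -> d = (0, 0, 0).
Proof.
intros Hv H1 H2 H3.
assert (E : pscal (vol e1 e2 e3) d =
  lin_comb (lorentz d e1, lorentz d e2, lorentz d e3)
           (lcross e2 e3) (lcross e3 e1) (lcross e1 e2)).
{ unfold vol; apply pt_eq; coords; ring. }
rewrite H1, H2, H3 in E.
apply pt_eq; apply Rmult_eq_reg_l with (vol e1 e2 e3); trivial;
  [apply (f_equal x1) in E | apply (f_equal x2) in E | apply (f_equal x3) in E];
  rewrite Rmult_0_r; etransitivity; try exact E; coords; ring.
Qed.

(** A vector is determined by its products with a basis. The minus sign comes from e3 being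
    timelike. *)
Lemma lorentz_basis_decomp (e1 e2 e3 v z : pt) :
  lorentz_basis e1 e2 e3 ->
  lorentz v e1 = x1 z -> lorentz v e2 = x2 z -> lorentz v e3 = - x3 z ->
  v = lin_comb z e1 e2 e3.
Proof.
intros He H1 H2 H3.
assert (E : psub v (lin_comb z e1 e2 e3) = (0, 0, 0)).
{ pose proof (vol_lorentz_basis _ _ _ He) as Hv.
  destruct He as (h11 & h22 & h33 & h12 & h13 & h23).
  apply (lorentz_nondegenerate e1 e2 e3); trivial.
  - transitivity (lorentz v e1 - x1 z * lorentz e1 e1 - x2 z * lorentz e1 e2
                  - x3 z * lorentz e1 e3); [coords; ring | rewrite H1, h11, h12, h13; ring].
  - transitivity (lorentz v e2 - x1 z * lorentz e1 e2 - x2 z * lorentz e2 e2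
                  - x3 z * lorentz e2 e3); [coords; ring | rewrite H2, h12, h22, h23; ring].
  - transitivity (lorentz v e3 - x1 z * lorentz e1 e3 - x2 z * lorentz e2 e3
                  - x3 z * lorentz e3 e3); [coords; ring | rewrite H3, h13, h23, h33; ring]. }
apply pt_eq; [apply (f_equal x1) in E | apply (f_equal x2) in E | apply (f_equal x3) in E];
  unfold psub, x1, x2, x3 in *; simpl in *; lra.
Qed.

(** Polarization: the product of two sides of a triangle is expressed by the squared lengths of its
    three sides. *)
Lemma isometry_lorentz (Phi : pt -> pt) (o p q : pt) :
  isometry Phi ->
  lorentz (psub (Phi p) (Phi o)) (psub (Phi q) (Phi o)) =
  lorentz (psub p o) (psub q o).
Proof.
intros H.
assert (Hpol : forall a b c, lorentz (psub a c) (psub b c) =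
  (lorentz (psub a c) (psub a c) + lorentz (psub b c) (psub b c)
   - lorentz (psub a b) (psub a b)) / 2).
{ intros a b c; coords; field. }
rewrite Hpol, (Hpol p q o), !H; reflexivity.
Qed.

(** The images of the standard basis, seen from the image of the origin, are again orthonormal, and
    the preserved products with them give the coordinates of the image of any z. *)
Lemma isometry_affine (Phi : pt -> pt) :
  isometry Phi ->
  exists c e1 e2 e3, lorentz_basis e1 e2 e3 /\
    forall z, Phi z = padd c (lin_comb z e1 e2 e3).
Proof.
intros H.
set (o := (0, 0, 0) : pt); set (b1 := (1, 0, 0) : pt).
set (b2 := (0, 1, 0) : pt); set (b3 := (0, 0, 1) : pt).
pose proof (fun p q => isometry_lorentz Phi o p q H) as HL.
exists (Phi o), (psub (Phi b1) (Phi o)), (psub (Phi b2) (Phi o)), (psub (Phi b3) (Phi o)).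
assert (He : lorentz_basis (psub (Phi b1) (Phi o)) (psub (Phi b2) (Phi o))
                           (psub (Phi b3) (Phi o))).
{ unfold lorentz_basis; rewrite !HL.
  unfold o, b1, b2, b3, lorentz, psub, x1, x2, x3; simpl; repeat split; ring. }
split; trivial; intros z.
assert (E : psub (Phi z) (Phi o) =
  lin_comb z (psub (Phi b1) (Phi o)) (psub (Phi b2) (Phi o)) (psub (Phi b3) (Phi o))).
{ apply lorentz_basis_decomp; trivial; rewrite HL;
    unfold o, b1, b2, b3, lorentz, psub, x1, x2, x3; simpl; ring. }
rewrite <- E; apply pt_eq; unfold padd, psub, x1, x2, x3; simpl; ring.
Qed.

(** * Infinitesimal rotations and Killing fields *)

Definition is_velocity (g : R -> pt) (k : pt) : Prop :=
  is_derive (fun t => x1 (g t)) 0 (x1 k) /\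
  is_derive (fun t => x2 (g t)) 0 (x2 k) /\
  is_derive (fun t => x3 (g t)) 0 (x3 k).

(* The velocity is the vector product [lcross z (g, - b, a)]. *)
Lemma rotation_generator (rot : R -> pt -> pt) :
  rot = rot_timelike_axis \/ rot = rot_spacelike_axis \/ rot = rot_lightlike_axis ->
  exists a b g : R, ~ (a = 0 /\ b = 0 /\ g = 0) /\
  forall z, rot 0 z = z /\
    is_velocity (fun t => rot t z)
      (a * x2 z + b * x3 z, - a * x1 z + g * x3 z, b * x1 z + g * x2 z).
Proof.
(* The axis vector (g, - b, a) is (0, 0, -1), (1, 0, 0) and (0, 1, 1) in the three cases. *)
intros [-> | [-> | ->]]; [exists (-1), 0, 0 | exists 0, 0, 1 | exists 1, (-1), 0];
  (split; [lra|]); intros [[p q] r];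
  unfold is_velocity, rot_timelike_axis, rot_spacelike_axis, rot_lightlike_axis, x1, x2, x3;
  simpl; (split;
  [ apply pt_eq; unfold x1, x2, x3; simpl;
    rewrite ?cos_0, ?sin_0, ?cosh_0, ?sinh_0; field
  | split; [|split]; auto_derive; trivial;
    rewrite ?cos_0, ?sin_0, ?cosh_0, ?sinh_0; field ]).
Qed.

Lemma is_derive_lin_comb (f1 f2 f3 : R -> R) (t l1 l2 l3 a b b' b'' : R) :
  is_derive f1 t l1 -> is_derive f2 t l2 -> is_derive f3 t l3 ->
  is_derive (fun t => a + (f1 t * b + (f2 t * b' + f3 t * b''))) t
            (l1 * b + (l2 * b' + l3 * b'')).
Proof.
intros H1 H2 H3; auto_derive.
- repeat split; eexists; eassumption.
- change (fun x : R => f1 x) with f1; change (fun x : R => f2 x) with f2;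
    change (fun x : R => f3 x) with f3.
  rewrite (is_derive_unique _ _ _ H1), (is_derive_unique _ _ _ H2),
    (is_derive_unique _ _ _ H3); ring.
Qed.

Lemma is_velocity_isometry (c e1 e2 e3 k : pt) (g : R -> pt) :
  is_velocity g k ->
  is_velocity (fun t => padd c (lin_comb (g t) e1 e2 e3)) (lin_comb k e1 e2 e3).
Proof.
intros (H1 & H2 & H3).
split; [|split];
  apply (is_derive_lin_comb (fun t => x1 (g t)) (fun t => x2 (g t)) (fun t => x3 (g t)));
  trivial.
Qed.

(** The generator of the rotation group is carried over by the affine map [Phi]; each point moves
    along its orbit, which stays in S for small times. *)
Lemma rotational_killing (S : pt -> Prop) :
  rotational S ->
  exists c n : pt, n <> (0, 0, 0) /\
    forall p, S p -> exists g : R -> pt,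
      g 0 = p /\ is_velocity g (lcross (psub p c) n) /\
      exists eps, 0 < eps /\ forall t, Rabs t < eps -> S (g t).
Proof.
intros [Phi [rot [HPhi [Hrot Hinv]]]].
destruct (isometry_affine Phi HPhi) as (c & e1 & e2 & e3 & He & HE).
destruct (rotation_generator rot Hrot) as (a & b & g & Hne & Hgen).
pose proof (vol_lorentz_basis _ _ _ He) as Hv.
(* This is the image of the axis (g, - b, a) under the linear part of [Phi], times vol e1 e2 e3 = 1
   or -1. Written with vector products of the basis, it covers both orientations at once. *)
exists c, (lin_comb (a, b, g) (lcross e2 e1) (lcross e1 e3) (lcross e2 e3)).
split.
{ intros E; apply Hne.
  (* The products of this vector with e3, e2, e1 are - a, - b and g times [vol]. *)
  assert (F : forall w, lorentz (lin_comb (a, b, g) (lcross e2 e1) (lcross e1 e3)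
    (lcross e2 e3)) w = 0) by (intros w; rewrite E; coords; ring).
  repeat split; apply Rmult_eq_reg_r with (vol e1 e2 e3); trivial; rewrite Rmult_0_l;
    [rewrite <- Ropp_0, <- (F e3) | rewrite <- Ropp_0, <- (F e2) | rewrite <- (F e1)];
    unfold vol; coords; ring. }
intros p Hp.
(* The preimage of p, read off from products with the basis. *)
set (z := (lorentz (psub p c) e1, lorentz (psub p c) e2, - lorentz (psub p c) e3) : pt).
assert (Hz : Phi z = p).
{ rewrite HE, <- (lorentz_basis_decomp e1 e2 e3 (psub p c) z He); trivial.
  - apply pt_eq; unfold padd, psub, x1, x2, x3; simpl; ring.
  - unfold z, x3; simpl; ring. }
destruct (Hgen z) as [Hrot0 Hvel].
exists (fun t => Phi (rot t z)); split; [rewrite Hrot0; trivial | split].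
- apply (is_velocity_isometry c e1 e2 e3) in Hvel.
  (* The coordinates of z being products with p - c, this is the expansion of a double vector
     product u x (v x w), a polynomial identity. *)
  assert (EK :
    lin_comb (a * x2 z + b * x3 z, - a * x1 z + g * x3 z, b * x1 z + g * x2 z) e1 e2 e3 =
    lcross (psub p c) (lin_comb (a, b, g) (lcross e2 e1) (lcross e1 e3) (lcross e2 e3))).
  { unfold z; apply pt_eq; coords; ring. }
  rewrite <- EK; destruct Hvel as (V1 & V2 & V3).
  split; [|split]; (eapply is_derive_ext; [intros t; rewrite HE; reflexivity | eassumption]).
- rewrite <- Hz in Hp; apply Hinv in Hp; exact Hp.
Qed.

(** * Implicit equation *)

(* Radius and center of the hyperbola cut out by the plane of height x. *)
Definition sec_radius (lam x : R) : R := cosh (sqrt lam * x) / sqrt lam.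

(** The primitive M of R^2 with M(0) = 0; the center of the section is (x, M, M). *)
Definition sec_center (lam x : R) : R :=
  (sqrt lam * x + cosh (sqrt lam * x) * sinh (sqrt lam * x)) / (2 * sqrt lam ^ 3).

Definition implicit (lam : R) (p : pt) : R :=
  (x2 p - x3 p) * (x2 p + x3 p - 2 * sec_center lam (x1 p))
  - sec_radius lam (x1 p) ^ 2.

Lemma sec_radius_pos (lam x : R) : 0 < lam -> 0 < sec_radius lam x.
Proof.
intros Hl; apply Rdiv_lt_0_compat; [apply cosh_pos | apply sqrt_lt_R0, Hl].
Qed.

Lemma x_expl_pos (lam r v : R) : 0 < lam -> D_expl lam r v -> 0 < x_expl lam r.
Proof.
intros Hl H; apply D_expl_iff in H; trivial; unfold x_expl.
apply Rmult_lt_0_compat; [|apply arcosh_pos, H].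
apply Rdiv_lt_0_compat; [lra | apply sqrt_lt_R0, Hl].
Qed.

Lemma sqrt_x_expl (lam r : R) :
  0 < lam -> sqrt lam * x_expl lam r = arcosh (sqrt lam * r).
Proof.
intros Hl; pose proof (sqrt_lt_R0 lam Hl); unfold x_expl; field; lra.
Qed.

Lemma sec_radius_x_expl (lam r v : R) :
  0 < lam -> D_expl lam r v -> sec_radius lam (x_expl lam r) = r.
Proof.
intros Hl H; pose proof (sqrt_lt_R0 lam Hl); apply D_expl_iff in H; trivial.
unfold sec_radius; rewrite (sqrt_x_expl lam r Hl), cosh_arcosh by trivial; field; lra.
Qed.

(** As w = sinh u, arcsinh w is u = k x, which turns [m_expl] into a function of the height. *)
Lemma sec_center_x_expl (lam r v : R) :
  0 < lam -> D_expl lam r v -> sec_center lam (x_expl lam r) = m_expl lam r.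
Proof.
intros Hl H; pose proof (sqrt_lt_R0 lam Hl).
pose proof (proj1 (D_expl_iff lam r v Hl) H) as H1.
unfold sec_center, m_expl; rewrite (sqrt_x_expl lam r Hl), (Rpower_3_2 lam Hl).
fold (speed lam r).
assert (E : speed lam r = sinh (arcosh (sqrt lam * r))).
{ rewrite (speed_alt lam r Hl), <- (cosh_arcosh _ H1) at 1.
  apply sqrt_cosh2_minus_1; left; apply arcosh_pos, H1. }
rewrite E, arcsinh_sinh, cosh_arcosh by trivial; field; lra.
Qed.

Lemma x_expl_sec_radius (lam x : R) :
  0 < lam -> 0 <= x -> x_expl lam (sec_radius lam x) = x.
Proof.
intros Hl Hx; pose proof (sqrt_lt_R0 lam Hl); unfold x_expl, sec_radius.
replace (sqrt lam * (cosh (sqrt lam * x) / sqrt lam)) with (cosh (sqrt lam * x))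
  by (field; lra).
rewrite arcosh_cosh by nra; field; lra.
Qed.

Lemma D_expl_sec_radius (lam x v : R) :
  0 < lam -> 0 < x -> D_expl lam (sec_radius lam x) v.
Proof.
intros Hl Hx; pose proof (sqrt_lt_R0 lam Hl).
apply D_expl_iff; trivial; unfold sec_radius.
replace (sqrt lam * (cosh (sqrt lam * x) / sqrt lam)) with (cosh (sqrt lam * x))
  by (field; lra).
apply one_lt_cosh, Rmult_lt_0_compat; lra.
Qed.

Lemma hyperbola_param (rho xi eta : R) :
  0 < rho -> 0 < xi -> xi * eta = rho ^ 2 ->
  exists s, rho * (cosh s - sinh s) = xi /\ rho * (cosh s + sinh s) = eta.
Proof.
(* The parameter is forced by cosh s - sinh s = exp (- s). *)
intros Hr Hx E; exists (- ln (xi / rho)).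
rewrite cosh_minus_sinh, cosh_plus_sinh, Ropp_involutive, exp_Ropp, exp_ln
  by (apply Rdiv_lt_0_compat; lra).
split; [field; lra|].
apply Rmult_eq_reg_l with xi; [rewrite E; field; lra | lra].
Qed.

Lemma X_expl_sec (lam x s : R) :
  0 < lam -> 0 < x ->
  X_expl lam (sec_radius lam x) s =
  (x, sec_center lam x + sec_radius lam x * cosh s,
      sec_center lam x + sec_radius lam x * sinh s).
Proof.
intros Hl Hx; unfold X_expl.
rewrite <- (sec_center_x_expl lam _ 0 Hl (D_expl_sec_radius lam x 0 Hl Hx)).
rewrite x_expl_sec_radius by lra.
apply pt_eq; unfold padd, pscal, x1, x2, x3; simpl; ring.
Qed.

(** The equation describes a hyperbola with two branches in each plane; x2 - x3 > 0 selects the one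
    parametrized by (cosh s, sinh s). *)
Lemma trace_expl_iff (lam : R) (p : pt) :
  0 < lam ->
  (trace (D_expl lam) (X_expl lam) p <->
   0 < x1 p /\ 0 < x2 p - x3 p /\ implicit lam p = 0).
Proof.
intros Hl; split.
- intros (r & v & HD & ->).
  pose proof (x_expl_pos lam r v Hl HD) as Hx.
  rewrite <- (sec_radius_x_expl lam r v Hl HD), (X_expl_sec lam _ v Hl Hx).
  set (x := x_expl lam r) in *; pose proof (sec_radius_pos lam x Hl) as Hr.
  unfold implicit, x1, x2, x3; simpl; split; [trivial | split].
  + replace (_ - _) with (sec_radius lam x * (cosh v - sinh v)) by ring.
    rewrite cosh_minus_sinh; apply Rmult_lt_0_compat; [trivial | apply exp_pos].
  + transitivity (sec_radius lam x ^ 2 * (cosh v ^ 2 - sinh v ^ 2 - 1)); [ring|].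
    rewrite cosh2_sinh2; ring.
- intros (Hx & Hxi & E); unfold implicit in E.
  destruct (hyperbola_param (sec_radius lam (x1 p)) (x2 p - x3 p)
              (x2 p + x3 p - 2 * sec_center lam (x1 p))) as (s & E1 & E2);
    [apply sec_radius_pos, Hl | trivial | lra |].
  exists (sec_radius lam (x1 p)), s; split; [apply D_expl_sec_radius; trivial|].
  rewrite (X_expl_sec lam _ s Hl Hx).
  apply pt_eq; unfold x1, x2, x3 in *; simpl; lra.
Qed.

(** * The surface is not rotational *)

Lemma is_derive_implicit (lam : R) (f1 f2 f3 : R -> R) (t l1 l2 l3 : R) :
  0 < lam -> is_derive f1 t l1 -> is_derive f2 t l2 -> is_derive f3 t l3 ->
  is_derive (fun t => implicit lam (f1 t, f2 t, f3 t)) t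
    ((l2 - l3) * (f2 t + f3 t - 2 * sec_center lam (f1 t))
     + (f2 t - f3 t) * (l2 + l3 - 2 * (sec_radius lam (f1 t) ^ 2 * l1))
     - 2 * sec_radius lam (f1 t) * sinh (sqrt lam * f1 t) * l1).
Proof.
intros Hl H1 H2 H3; pose proof (sqrt_lt_R0 lam Hl) as Hk.
unfold implicit, sec_center, sec_radius, x1, x2, x3; simpl; auto_derive.
- repeat split; eexists; eassumption.
- change (fun x : R => f1 x) with f1; change (fun x : R => f2 x) with f2;
    change (fun x : R => f3 x) with f3.
  rewrite (is_derive_unique _ _ _ H1), (is_derive_unique _ _ _ H2),
    (is_derive_unique _ _ _ H3).
  pose proof (cosh2_sinh2 (sqrt lam * f1 t)) as Hch.
  set (c := cosh _) in *; set (s := sinh _) in *; set (k := sqrt lam) in *.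
  apply Rminus_diag_uniq.
  field_simplify; [|lra].
  (* M' comes out as (1 + c^2 + s^2) / (2 k^2), which is R^2 only through c^2 = 1 + s^2. *)
  replace (c ^ 2) with (1 + s ^ 2) by lra; field; lra.
Qed.

(** Four sample points determine a cubic; the linear system is of Vandermonde type. *)
Lemma cubic_zero (a3 a2 a1 a0 : R) :
  (forall xi, 0 < xi -> a3 * xi ^ 3 + a2 * xi ^ 2 + a1 * xi + a0 = 0) ->
  a3 = 0 /\ a2 = 0 /\ a1 = 0 /\ a0 = 0.
Proof.
intros H.
pose proof (H 1 ltac:(lra)); pose proof (H 2 ltac:(lra)).
pose proof (H 3 ltac:(lra)); pose proof (H 4 ltac:(lra)).
lra.
Qed.

Lemma sec_center_1_2 (lam : R) : 0 < lam -> sec_center lam 1 < sec_center lam 2.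
Proof.
intros Hl; pose proof (sqrt_lt_R0 lam Hl) as Hk; unfold sec_center.
apply Rmult_lt_compat_r; [apply Rinv_0_lt_compat; pose proof (pow_lt _ 3 Hk); lra|].
pose proof (cosh_sinh_lt (sqrt lam * 1) (sqrt lam * 2) ltac:(lra) ltac:(lra)); lra.
Qed.

(* Along the section of height x, the derivative of [implicit] in the direction
   of the Killing field, times xi = x2 - x3, is a cubic polynomial in xi whose
   coefficients depend on x. *)
Lemma not_rotational_expl (lam : R) :
  0 < lam -> ~ rotational (trace (D_expl lam) (X_expl lam)).
Proof.
intros Hl Hrot; pose proof (sqrt_lt_R0 lam Hl) as Hk.
destruct (rotational_killing _ Hrot) as ([[c1 c2] c3] & [[n1 n2] n3] & Hn & HK).
apply Hn; clear Hn.
(* (x, p2, p3) is the point of the section with x2 - x3 = xi and x2 + x3 = 2 M + r^2 / xi; l is the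
   Killing vector there, and the equation says that the derivative of [implicit] along l
   vanishes. *)
assert (HT : forall x xi, 0 < x -> 0 < xi ->
  let M := sec_center lam x in let r := sec_radius lam x in
  let p2 := M + (r ^ 2 / xi + xi) / 2 in let p3 := M + (r ^ 2 / xi - xi) / 2 in
  let l := lcross (x - c1, p2 - c2, p3 - c3) (n1, n2, n3) in
  (x2 l - x3 l) * (r ^ 2 / xi) + xi * (x2 l + x3 l - 2 * (r ^ 2 * x1 l))
  - 2 * r * sinh (sqrt lam * x) * x1 l = 0).
{ intros x xi Hx Hxi M r p2 p3 l.
  destruct (HK (x, p2, p3)) as (g & Hg0 & (V1 & V2 & V3) & eps & Heps & Hg).
  { apply trace_expl_iff; trivial; unfold implicit, x1, x2, x3, p2, p3; simpl.
    fold M r; split; [trivial | split; [lra | field; lra]]. }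
  (* The orbit stays on the surface for |t| < eps, so [implicit] is zero along it; the chain rule
     computes the same derivative below. *)
  assert (D0 : is_derive (fun t => implicit lam (g t)) 0 0).
  { apply is_derive_ext_loc with (fun _ : R => 0); [|auto_derive; trivial].
    exists (mkposreal eps Heps); intros t Ht; symmetry.
    apply (trace_expl_iff lam (g t) Hl), Hg.
    unfold ball in Ht; simpl in Ht; unfold AbsRing_ball, abs, minus, plus, opp in Ht.
    simpl in Ht; rewrite Ropp_0, Rplus_0_r in Ht; exact Ht. }
  pose proof (is_derive_implicit lam _ _ _ _ _ _ _ Hl V1 V2 V3) as D1.
  apply is_derive_ext with (g := fun t => implicit lam (g t)) in D1;
    [|intros t; f_equal; apply pt_eq; reflexivity].
  transitivity (Derive (fun t => implicit lam (g t)) 0);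
    [|exact (is_derive_unique _ _ _ D0)].
  refine (eq_trans _ (eq_sym (is_derive_unique _ _ _ D1))); rewrite Hg0.
  unfold l, psub, x1, x2, x3; simpl; fold M r; unfold p2, p3; field; lra. }
(* These are the coefficients of xi^3, xi^2 and 1 in xi times the equation of [HT], with positive
   powers of r divided out; h is R R'. *)
assert (HC : forall x, 0 < x ->
  let M := sec_center lam x in let r := sec_radius lam x in
  let h := r * sinh (sqrt lam * x) in
  let k := (M - c2) * n3 - (M - c3) * n2 in
  n3 + n2 = 0 /\
  (2 * M - c2 - c3) * n1 - (x - c1 + h) * (n3 + n2) - 2 * r ^ 2 * k = 0 /\
  (c2 - c3) * n1 - (x - c1 + h) * (n3 - n2) = 0).
{ intros x Hx M r h k; pose proof (sec_radius_pos lam x Hl) as Hr; fold r in Hr.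
  destruct (cubic_zero (- r ^ 2 * (n3 + n2))
    ((2 * M - c2 - c3) * n1 - (x - c1 + h) * (n3 + n2) - 2 * r ^ 2 * k)
    (- r ^ 4 * (n3 - n2) - 2 * h * k)
    (((c2 - c3) * n1 - (x - c1 + h) * (n3 - n2)) * r ^ 2)) as (E3 & E2 & _ & E0).
  { intros xi Hxi; specialize (HT x xi Hx Hxi); cbv zeta in HT; fold M r in HT.
    apply (f_equal (Rmult xi)) in HT; rewrite Rmult_0_r in HT; rewrite <- HT.
    unfold lcross, x1, x2, x3, k, h; simpl; field; lra. }
  assert (r ^ 2 <> 0) by (apply pow_nonzero; lra).
  split; [|split; trivial].
  - apply Rmult_eq_reg_l with (- r ^ 2); lra.
  - apply Rmult_eq_reg_r with (r ^ 2); lra. }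
destruct (HC 1 ltac:(lra)) as (E3 & E2 & E1); destruct (HC 2 ltac:(lra)) as (_ & E2' & E1').
pose proof (cosh_sinh_lt (sqrt lam * 1) (sqrt lam * 2) ltac:(lra) ltac:(lra)) as Hh.
pose proof (sec_center_1_2 lam Hl) as HM.
assert (H32 : n3 - n2 = 0).
{ apply (Rmult_lt_compat_r (/ sqrt lam)) in Hh; [|apply Rinv_0_lt_compat, Hk].
  unfold sec_radius in E1, E1'.
  (* Subtracting the third condition at heights 1 and 2 leaves (1 + h(2) - h(1)) (n3 - n2) = 0, with
     h(2) > h(1). *)
  apply Rmult_eq_reg_l with
    (1 + cosh (sqrt lam * 2) * sinh (sqrt lam * 2) * / sqrt lam
       - cosh (sqrt lam * 1) * sinh (sqrt lam * 1) * / sqrt lam); [|lra].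
  unfold Rdiv in E1, E1'; lra. }
assert (n2 = 0) by lra; assert (n3 = 0) by lra; subst n2 n3.
assert (n1 = 0); [|congruence].
(* With n2 = n3 = 0 the second condition reads (2 M - c2 - c3) n1 = 0; again the two heights are
   subtracted. *)
apply Rmult_eq_reg_l with (2 * (sec_center lam 2 - sec_center lam 1)); lra.
Qed.

(** * Smoothness *)

Lemma open_section_1 (D : R -> R -> Prop) (u v : R) :
  open (fun w : R * R => D (fst w) (snd w)) -> D u v -> locally u (fun t => D t v).
Proof.
intros HO H; destruct (HO (u, v) H) as [eps He]; exists eps; intros t Ht.
apply (He (t, v)); split; [exact Ht | apply ball_center].
Qed.

Lemma open_section_2 (D : R -> R -> Prop) (u v : R) :
  open (fun w : R * R => D (fst w) (snd w)) -> D u v -> locally v (fun t => D u t).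
Proof.
intros HO H; destruct (HO (u, v) H) as [eps He]; exists eps; intros t Ht.
apply (He (u, t)); split; [apply ball_center | exact Ht].
Qed.

Lemma is_derive_section_1 (D : R -> R -> Prop) (f g : R -> R -> R) (u v l : R) :
  open (fun w : R * R => D (fst w) (snd w)) ->
  (forall u v, D u v -> f u v = g u v) -> D u v ->
  is_derive (fun t => g t v) u l -> is_derive (fun t => f t v) u l.
Proof.
intros HO E H Hd; apply is_derive_ext_loc with (fun t => g t v); trivial.
apply (filter_imp (fun t => D t v)); [|apply open_section_1; trivial].
intros t Ht; symmetry; apply E, Ht.
Qed.

Lemma is_derive_section_2 (D : R -> R -> Prop) (f g : R -> R -> R) (u v l : R) :
  open (fun w : R * R => D (fst w) (snd w)) ->
  (forall u v, D u v -> f u v = g u v) -> D u v ->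
  is_derive (fun t => g u t) v l -> is_derive (fun t => f u t) v l.
Proof.
intros HO E H Hd; apply is_derive_ext_loc with (fun t => g u t); trivial.
apply (filter_imp (fun t => D u t)); [|apply open_section_2; trivial].
intros t Ht; symmetry; apply E, Ht.
Qed.

(** [d1 f] and [d2 f] agree with members of the family on D only, so the induction on k runs over
    all f that coincide on D with some member g; D being open, this passes to partial
    derivatives. *)
Lemma smooth_of_family (D : R -> R -> Prop) (F : (R -> R -> R) -> Prop) :
  open (fun w : R * R => D (fst w) (snd w)) ->
  (forall f, F f -> forall u v, D u v ->
     continuous (fun w : R * R => f (fst w) (snd w)) (u, v)) ->
  (forall f, F f -> exists f1 f2, F f1 /\ F f2 /\ forall u v, D u v ->
     is_derive (fun t => f t v) u (f1 u v) /\ is_derive (fun t => f u t) v (f2 u v)) ->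
  forall f g, F g -> (forall u v, D u v -> f u v = g u v) -> smooth D f.
Proof.
intros HO HC HD f g Hg E k; revert f g Hg E; induction k as [|k IH]; intros f g Hg E; simpl.
- intros u v Huv; apply continuous_ext_loc with (fun w => g (fst w) (snd w)).
  + apply (filter_imp (fun w : R * R => D (fst w) (snd w))); [|apply (HO (u, v) Huv)].
    intros w Hw; symmetry; apply E, Hw.
  + apply HC; trivial.
- destruct (HD g Hg) as (g1 & g2 & Hg1 & Hg2 & Hd); split; [|split].
  + intros u v Huv; destruct (Hd u v Huv) as [H1 H2]; split; eexists;
      [eapply is_derive_section_1 | eapply is_derive_section_2]; eassumption.
  + apply (IH _ g1 Hg1); intros u v Huv; apply is_derive_unique.
    apply is_derive_section_1 with D g; trivial; apply Hd, Huv.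
  + apply (IH _ g2 Hg2); intros u v Huv; apply is_derive_unique.
    apply is_derive_section_2 with D g; trivial; apply Hd, Huv.
Qed.

Lemma is_derive_inv_speed (lam r v : R) :
  0 < lam -> D_expl lam r v ->
  is_derive (fun t => / speed lam t) r (- lam * r * (/ speed lam r) ^ 3).
Proof.
intros Hl H; pose proof (speed_pos lam r v Hl H) as Hw.
pose proof (radicand_pos lam r v Hl H) as Hr.
unfold speed in *; auto_derive.
- replace (lam * (r * (r * 1)) + - (1)) with (lam * r ^ 2 - 1) by ring.
  repeat split; trivial; lra.
- replace (lam * (r * (r * 1)) + - (1)) with (lam * r ^ 2 - 1) by ring.
  field; lra.
Qed.

(* A ring of functions closed under partial derivatives, because x' = 1 / w,
   m' = r^2 / w and (1 / w)' = - lam r / w^3 for w = speed lam r. *)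
Inductive profile_ring (lam : R) : (R -> R -> R) -> Prop :=
  | pr_const (c : R) : profile_ring lam (fun _ _ => c)
  | pr_radius : profile_ring lam (fun r _ => r)
  | pr_inv_speed : profile_ring lam (fun r _ => / speed lam r)
  | pr_x : profile_ring lam (fun r _ => x_expl lam r)
  | pr_m : profile_ring lam (fun r _ => m_expl lam r)
  | pr_cosh : profile_ring lam (fun _ v => cosh v)
  | pr_sinh : profile_ring lam (fun _ v => sinh v)
  | pr_plus (f g : R -> R -> R) :
      profile_ring lam f -> profile_ring lam g -> profile_ring lam (fun r v => f r v + g r v)
  | pr_mult (f g : R -> R -> R) :
      profile_ring lam f -> profile_ring lam g -> profile_ring lam (fun r v => f r v * g r v).

Lemma continuous_of_fst (h : R -> R) (u v l : R) :
  is_derive h u l -> continuous (fun w : R * R => h (fst w)) (u, v).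
Proof.
intros H; apply (continuous_comp fst h); [apply continuous_fst|].
apply (ex_derive_continuous (V := R_NormedModule)); exists l; exact H.
Qed.

Lemma continuous_of_snd (h : R -> R) (u v l : R) :
  is_derive h v l -> continuous (fun w : R * R => h (snd w)) (u, v).
Proof.
intros H; apply (continuous_comp snd h); [apply continuous_snd|].
apply (ex_derive_continuous (V := R_NormedModule)); exists l; exact H.
Qed.

Lemma is_derive_id_R (t : R) : is_derive (fun x : R => x) t 1.
Proof. auto_derive; trivial. Qed.

Lemma is_derive_const_R (c t : R) : is_derive (fun _ : R => c) t 0.
Proof. auto_derive; trivial. Qed.

Lemma is_derive_cosh (t : R) : is_derive cosh t (sinh t).
Proof. apply is_derive_Reals, derivable_pt_lim_cosh. Qed.

Lemma is_derive_sinh (t : R) : is_derive sinh t (cosh t).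
Proof. apply is_derive_Reals, derivable_pt_lim_sinh. Qed.

Lemma profile_ring_continuous (lam : R) (f : R -> R -> R) :
  0 < lam -> profile_ring lam f -> forall r v, D_expl lam r v ->
  continuous (fun w : R * R => f (fst w) (snd w)) (r, v).
Proof.
intros Hl Hf r v H; induction Hf.
- apply continuous_const.
- apply continuous_fst.
- exact (continuous_of_fst (fun r => / speed lam r) r v _ (is_derive_inv_speed lam r v Hl H)).
- exact (continuous_of_fst (x_expl lam) r v _ (is_derive_x_expl lam r v Hl H)).
- exact (continuous_of_fst (m_expl lam) r v _ (is_derive_m_expl lam r v Hl H)).
- exact (continuous_of_snd cosh r v _ (is_derive_cosh v)).
- exact (continuous_of_snd sinh r v _ (is_derive_sinh v)).
- apply (continuous_plus (fun w => f (fst w) (snd w)) (fun w => g (fst w) (snd w))); trivial.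
- apply (continuous_mult (fun w => f (fst w) (snd w)) (fun w => g (fst w) (snd w))); trivial.
Qed.

Lemma profile_ring_derive (lam : R) (f : R -> R -> R) :
  0 < lam -> profile_ring lam f ->
  exists f1 f2, profile_ring lam f1 /\ profile_ring lam f2 /\
  forall r v, D_expl lam r v ->
    is_derive (fun t => f t v) r (f1 r v) /\ is_derive (fun t => f r t) v (f2 r v).
Proof.
intros Hl Hf.
assert (Hfst : forall h h' : R -> R, profile_ring lam (fun r _ => h' r) ->
  (forall r v, D_expl lam r v -> is_derive h r (h' r)) ->
  exists f1 f2, profile_ring lam f1 /\ profile_ring lam f2 /\
    forall r v, D_expl lam r v ->
    is_derive h r (f1 r v) /\ is_derive (fun _ => h r) v (f2 r v)).
{ intros h h' Hh' Hd; exists (fun r _ => h' r), (fun _ _ => 0).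
  split; [trivial | split; [constructor|]].
  intros r v H; split; [apply (Hd r v H) | apply is_derive_const_R]. }
assert (Hsnd : forall h h' : R -> R, profile_ring lam (fun _ v => h' v) ->
  (forall v, is_derive h v (h' v)) ->
  exists f1 f2, profile_ring lam f1 /\ profile_ring lam f2 /\
    forall r v, D_expl lam r v ->
    is_derive (fun _ => h v) r (f1 r v) /\ is_derive h v (f2 r v)).
{ intros h h' Hh' Hd; exists (fun _ _ => 0), (fun _ v => h' v).
  split; [constructor | split; [trivial|]].
  intros r v H; split; [apply is_derive_const_R | apply Hd]. }
induction Hf as [c | | | | | | | f g Hf IHf Hg IHg | f g Hf IHf Hg IHg].
- apply (Hfst (fun _ => c) (fun _ => 0)); [constructor|].
  intros; apply is_derive_const_R.
- apply (Hfst (fun r => r) (fun _ => 1)); [constructor|].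
  intros; apply is_derive_id_R.
- apply (Hfst (fun r => / speed lam r)
    (* The cube is spelled out as a product, convertible with the power, so that the constructors of
       [profile_ring] apply; likewise for r^2 in the case of [m_expl]. *)
    (fun r => (- lam * r) * (/ speed lam r * (/ speed lam r * (/ speed lam r * 1))))).
  + repeat constructor.
  + intros r v H; apply (is_derive_inv_speed lam r v Hl H).
- apply (Hfst (x_expl lam) (fun r => / speed lam r)); [constructor|].
  intros r v; apply (is_derive_x_expl lam r v Hl).
- apply (Hfst (m_expl lam) (fun r => (r * (r * 1)) * / speed lam r)); [repeat constructor|].
  intros r v; apply (is_derive_m_expl lam r v Hl).
- apply (Hsnd cosh sinh); [constructor | apply is_derive_cosh].
- apply (Hsnd sinh cosh); [constructor | apply is_derive_sinh].
- destruct IHf as (f1 & f2 & Hf1 & Hf2 & Hdf), IHg as (g1 & g2 & Hg1 & Hg2 & Hdg).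
  exists (fun r v => f1 r v + g1 r v), (fun r v => f2 r v + g2 r v).
  split; [constructor; trivial | split; [constructor; trivial|]].
  intros r v H; destruct (Hdf r v H), (Hdg r v H); split.
  + apply (is_derive_plus (fun t => f t v) (fun t => g t v)); trivial.
  + apply (is_derive_plus (fun t => f r t) (fun t => g r t)); trivial.
- destruct IHf as (f1 & f2 & Hf1 & Hf2 & Hdf), IHg as (g1 & g2 & Hg1 & Hg2 & Hdg).
  exists (fun r v => f1 r v * g r v + f r v * g1 r v),
         (fun r v => f2 r v * g r v + f r v * g2 r v).
  split; [repeat constructor; trivial | split; [repeat constructor; trivial|]].
  intros r v H; destruct (Hdf r v H), (Hdg r v H); split.
  + apply (is_derive_mult (fun t => f t v) (fun t => g t v)); trivial; apply Rmult_comm.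
  + apply (is_derive_mult (fun t => f r t) (fun t => g r t)); trivial; apply Rmult_comm.
Qed.

(** * Regularity and mean curvature *)

(** The right-hand side of the characterization for fixed constants. The last two shifts are equal
    since m multiplies the vector (1, 1). *)
Definition translated_expl (lam c1 c2 : R) (D : R -> R -> Prop) (X : R -> R -> pt) : Prop :=
  (forall r v, D r v <-> D_expl lam r v) /\
  (forall r v, D r v -> X r v = padd (c1, c2, c2) (X_expl lam r v)).

Lemma translated_expl_open (lam c1 c2 : R) (D : R -> R -> Prop) (X : R -> R -> pt) :
  translated_expl lam c1 c2 D X -> open (fun w : R * R => D (fst w) (snd w)).
Proof.
intros [HD _].
apply open_ext with (fun w => 1 / sqrt lam < fst w).
- intros w; symmetry; apply HD.
- apply (open_comp fst (fun r => 1 / sqrt lam < r)); [|apply open_gt].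
  intros [u v] _; apply continuous_fst.
Qed.

Lemma translated_expl_coords (lam c1 c2 : R) (D : R -> R -> Prop) (X : R -> R -> pt) :
  translated_expl lam c1 c2 D X -> forall r v, D r v ->
  x1 (X r v) = c1 + x_expl lam r /\
  x2 (X r v) = c2 + m_expl lam r + r * cosh v /\
  x3 (X r v) = c2 + m_expl lam r + r * sinh v.
Proof.
intros [_ HX] r v H; rewrite (HX r v H).
unfold X_expl, padd, pscal, x1, x2, x3; simpl; repeat split; ring.
Qed.

Lemma translated_expl_smooth (lam c1 c2 : R) (D : R -> R -> Prop) (X : R -> R -> pt) :
  0 < lam -> translated_expl lam c1 c2 D X ->
  smooth D (fun u v => x1 (X u v)) /\ smooth D (fun u v => x2 (X u v)) /\
  smooth D (fun u v => x3 (X u v)).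
Proof.
intros Hl H; pose proof (translated_expl_open _ _ _ _ _ H) as HO.
pose proof (translated_expl_coords _ _ _ _ _ H) as HX; destruct H as [HD _].
assert (HS : forall f g, profile_ring lam g ->
  (forall u v, D u v -> f u v = g u v) -> smooth D f).
{ apply smooth_of_family; trivial.
  - intros f Hf u v Huv; apply (profile_ring_continuous lam); trivial; apply HD, Huv.
  - intros f Hf; destruct (profile_ring_derive lam f Hl Hf) as (f1 & f2 & H1 & H2 & Hd).
    exists f1, f2; split; [trivial | split; [trivial|]].
    intros u v Huv; apply Hd, HD, Huv. }
split; [|split].
- apply HS with (fun r _ => c1 + x_expl lam r); [repeat constructor | apply HX].
- apply HS with (fun r v => c2 + m_expl lam r + r * cosh v); [repeat constructor | apply HX].
- apply HS with (fun r v => c2 + m_expl lam r + r * sinh v); [repeat constructor | apply HX].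
Qed.

(** * First and second partial derivatives *)

Lemma pd1_eq (D : R -> R -> Prop) (X Y : R -> R -> pt) (u v l1 l2 l3 : R) :
  open (fun w : R * R => D (fst w) (snd w)) ->
  (forall u v, D u v -> X u v = Y u v) -> D u v ->
  is_derive (fun t => x1 (Y t v)) u l1 -> is_derive (fun t => x2 (Y t v)) u l2 ->
  is_derive (fun t => x3 (Y t v)) u l3 -> pd1 X u v = (l1, l2, l3).
Proof.
intros HO E H H1 H2 H3.
assert (Ex : forall x : pt -> R, forall u v, D u v -> x (X u v) = x (Y u v))
  by (intros x u' v' H'; rewrite (E u' v' H'); reflexivity).
apply pt_eq;
  [ exact (is_derive_unique _ _ _ (is_derive_section_1 D _ _ _ _ _ HO (Ex x1) H H1))
  | exact (is_derive_unique _ _ _ (is_derive_section_1 D _ _ _ _ _ HO (Ex x2) H H2))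
  | exact (is_derive_unique _ _ _ (is_derive_section_1 D _ _ _ _ _ HO (Ex x3) H H3)) ].
Qed.

Lemma pd2_eq (D : R -> R -> Prop) (X Y : R -> R -> pt) (u v l1 l2 l3 : R) :
  open (fun w : R * R => D (fst w) (snd w)) ->
  (forall u v, D u v -> X u v = Y u v) -> D u v ->
  is_derive (fun t => x1 (Y u t)) v l1 -> is_derive (fun t => x2 (Y u t)) v l2 ->
  is_derive (fun t => x3 (Y u t)) v l3 -> pd2 X u v = (l1, l2, l3).
Proof.
intros HO E H H1 H2 H3.
assert (Ex : forall x : pt -> R, forall u v, D u v -> x (X u v) = x (Y u v))
  by (intros x u' v' H'; rewrite (E u' v' H'); reflexivity).
apply pt_eq;
  [ exact (is_derive_unique _ _ _ (is_derive_section_2 D _ _ _ _ _ HO (Ex x1) H H1))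
  | exact (is_derive_unique _ _ _ (is_derive_section_2 D _ _ _ _ _ HO (Ex x2) H H2))
  | exact (is_derive_unique _ _ _ (is_derive_section_2 D _ _ _ _ _ HO (Ex x3) H H3)) ].
Qed.

Lemma translated_expl_eq (lam c1 c2 : R) (D : R -> R -> Prop) (X : R -> R -> pt) :
  translated_expl lam c1 c2 D X -> forall r v, D r v ->
  X r v = (c1 + x_expl lam r, c2 + m_expl lam r + r * cosh v,
           c2 + m_expl lam r + r * sinh v).
Proof.
intros H r v Hrv; apply pt_eq; apply (translated_expl_coords _ _ _ _ _ H r v Hrv).
Qed.

Lemma translated_expl_pd1 (lam c1 c2 : R) (D : R -> R -> Prop) (X : R -> R -> pt) :
  0 < lam -> translated_expl lam c1 c2 D X -> forall r v, D r v ->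
  pd1 X r v = (/ speed lam r, r ^ 2 / speed lam r + cosh v,
               r ^ 2 / speed lam r + sinh v).
Proof.
intros Hl H r v Hrv.
pose proof (proj1 (proj1 H r v) Hrv) as HD.
pose proof (is_derive_x_expl lam r v Hl HD) as Hx.
pose proof (is_derive_m_expl lam r v Hl HD) as Hm.
assert (HL : forall c d, is_derive (fun t => c + m_expl lam t + t * d) r
                           (r ^ 2 / speed lam r + d)).
{ intros c d; auto_derive; [repeat split; eexists; exact Hm|].
  change (fun x : R => m_expl lam x) with (m_expl lam).
  rewrite (is_derive_unique _ _ _ Hm); ring. }
eapply pd1_eq;
  [eapply translated_expl_open, H | apply (translated_expl_eq _ _ _ _ _ H) | trivial | | |];
  unfold x1, x2, x3; simpl fst; simpl snd; try apply HL.
auto_derive; [repeat split; eexists; exact Hx|].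
change (fun x : R => x_expl lam x) with (x_expl lam).
rewrite (is_derive_unique _ _ _ Hx); ring.
Qed.

Lemma translated_expl_pd2 (lam c1 c2 : R) (D : R -> R -> Prop) (X : R -> R -> pt) :
  translated_expl lam c1 c2 D X -> forall r v, D r v ->
  pd2 X r v = (0, r * sinh v, r * cosh v).
Proof.
intros H r v Hrv.
eapply pd2_eq;
  [eapply translated_expl_open, H | apply (translated_expl_eq _ _ _ _ _ H) | trivial | | |];
  unfold x1, x2, x3; simpl fst; simpl snd; auto_derive; trivial; ring.
Qed.

(** Here [pd1 X] takes the place of the surface, its values on D being given by
    [translated_expl_pd1]. *)
Lemma translated_expl_pd11 (lam c1 c2 : R) (D : R -> R -> Prop) (X : R -> R -> pt) :
  0 < lam -> translated_expl lam c1 c2 D X -> forall r v, D r v ->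
  pd1 (pd1 X) r v =
  (- lam * r * (/ speed lam r) ^ 3,
   2 * r / speed lam r - lam * r ^ 3 * (/ speed lam r) ^ 3,
   2 * r / speed lam r - lam * r ^ 3 * (/ speed lam r) ^ 3).
Proof.
intros Hl H r v Hrv.
pose proof (proj1 (proj1 H r v) Hrv) as HD.
pose proof (is_derive_inv_speed lam r v Hl HD) as Hw.
assert (HL : forall d, is_derive (fun t => t ^ 2 / speed lam t + d) r
  (2 * r / speed lam r - lam * r ^ 3 * (/ speed lam r) ^ 3)).
{ intros d; replace (2 * r / speed lam r - lam * r ^ 3 * (/ speed lam r) ^ 3) with
    (2 * r * / speed lam r + r ^ 2 * (- lam * r * (/ speed lam r) ^ 3) + 0)
    by (unfold Rdiv; ring).
  apply (is_derive_plus (fun t => t ^ 2 / speed lam t) (fun _ => d));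
    [|apply is_derive_const_R].
  apply (is_derive_mult (fun t => t ^ 2) (fun t => / speed lam t));
    [auto_derive; trivial; ring | exact Hw | apply Rmult_comm]. }
eapply pd1_eq;
  [eapply translated_expl_open, H | apply (translated_expl_pd1 _ _ _ _ _ Hl H) | trivial | | |];
  unfold x1, x2, x3; simpl fst; simpl snd; [exact Hw | apply HL | apply HL].
Qed.

Lemma translated_expl_pd12 (lam c1 c2 : R) (D : R -> R -> Prop) (X : R -> R -> pt) :
  0 < lam -> translated_expl lam c1 c2 D X -> forall r v, D r v ->
  pd2 (pd1 X) r v = (0, sinh v, cosh v).
Proof.
intros Hl H r v Hrv.
eapply pd2_eq;
  [eapply translated_expl_open, H | apply (translated_expl_pd1 _ _ _ _ _ Hl H) | trivial | | |];
  unfold x1, x2, x3; simpl fst; simpl snd; auto_derive; trivial; ring.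
Qed.

Lemma translated_expl_pd22 (lam c1 c2 : R) (D : R -> R -> Prop) (X : R -> R -> pt) :
  translated_expl lam c1 c2 D X -> forall r v, D r v ->
  pd2 (pd2 X) r v = (0, r * cosh v, r * sinh v).
Proof.
intros H r v Hrv.
eapply pd2_eq;
  [eapply translated_expl_open, H | apply (translated_expl_pd2 _ _ _ _ _ H) | trivial | | |];
  unfold x1, x2, x3; simpl fst; simpl snd; auto_derive; trivial; ring.
Qed.

Lemma translated_expl_regular (lam c1 c2 : R) (D : R -> R -> Prop) (X : R -> R -> pt) :
  0 < lam -> translated_expl lam c1 c2 D X -> regular_surface D X.
Proof.
intros Hl H; destruct (translated_expl_smooth _ _ _ _ _ Hl H) as (S1 & S2 & S3).
pose proof (translated_expl_pd1 _ _ _ _ _ Hl H) as HP1.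
pose proof (translated_expl_pd2 _ _ _ _ _ H) as HP2.
pose proof (translated_expl_open _ _ _ _ _ H) as HO; destruct H as [HD _].
split; [|repeat (split; [assumption|])].
- exists (1 / sqrt lam + 1), 0; apply HD; unfold D_expl; lra.
- intros r v Hrv E; rewrite (HP1 r v Hrv), (HP2 r v Hrv) in E.
  (* As [pd2 X] has no x1 component, the second component of the vector product is - r cosh v / w,
     which is negative. *)
  apply HD in Hrv; apply (f_equal x2) in E.
  unfold lcross, x1, x2, x3 in E; simpl in E.
  assert (0 < / speed lam r * (r * cosh v)); [|lra].
  apply Rmult_lt_0_compat; [apply Rinv_0_lt_compat, (speed_pos lam r v Hl Hrv)|].
  apply Rmult_lt_0_compat; [apply (D_expl_pos lam r v Hl Hrv) | apply cosh_pos].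
Qed.

(** The normalizing factor of the unit normal comes out of the numerator, so the plain vector
    product can be used instead. *)
Lemma mean_curvature_zero (X : R -> R -> pt) (u v : R) :
  let n := lcross (pd1 X u v) (pd2 X u v) in
  lorentz n (pd1 (pd1 X) u v) * ffG X u v - 2 * lorentz n (pd2 (pd1 X) u v) * ffF X u v
    + lorentz n (pd2 (pd2 X) u v) * ffE X u v = 0 ->
  mean_curvature X u v = 0.
Proof.
intros n E; unfold mean_curvature, sfe, sff, sfg, unit_normal; fold n.
assert (HL : forall k p q, lorentz (pscal k p) q = k * lorentz p q)
  by (intros; coords; ring).
rewrite !(HL _ n); set (k := / sqrt _).
replace (k * _ * _ - _ + _) with
  (k * (lorentz n (pd1 (pd1 X) u v) * ffG X u v
        - 2 * lorentz n (pd2 (pd1 X) u v) * ffF X u v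
        + lorentz n (pd2 (pd2 X) u v) * ffE X u v)) by ring.
rewrite E; unfold Rdiv; ring.
Qed.

Lemma translated_expl_ZMC (lam c1 c2 : R) (D : R -> R -> Prop) (X : R -> R -> pt) :
  0 < lam -> translated_expl lam c1 c2 D X -> ZMC D X.
Proof.
intros Hl H r v Hrv _; apply mean_curvature_zero; cbv zeta.
unfold ffE, ffF, ffG.
rewrite (translated_expl_pd11 _ _ _ _ _ Hl H r v Hrv),
  (translated_expl_pd12 _ _ _ _ _ Hl H r v Hrv), (translated_expl_pd22 _ _ _ _ _ H r v Hrv),
  (translated_expl_pd1 _ _ _ _ _ Hl H r v Hrv), (translated_expl_pd2 _ _ _ _ _ H r v Hrv).
apply (proj1 H) in Hrv; pose proof (speed_pos lam r v Hl Hrv) as Hw.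
pose proof (speed_sqr lam r v Hl Hrv) as Hw2.
pose proof (cosh2_sinh2 v) as Hv.
coords.
set (w := speed lam r) in *; set (c := cosh v) in *; set (s := sinh v) in *.
apply Rmult_eq_reg_r with (w ^ 3); [|apply pow_nonzero; lra].
(* The numerator times w^3, factored as a polynomial in independent c, s, w; c^2 - s^2 = 1 and lam
   r^2 - w^2 = 1 make the last factor vanish. *)
transitivity (r ^ 2 * (c ^ 2 - s ^ 2) * ((c ^ 2 - s ^ 2) * (lam * r ^ 2 - w ^ 2) - 1));
  [field; lra|].
replace (c ^ 2 - s ^ 2) with 1 by lra; replace (w ^ 2) with (lam * r ^ 2 - 1) by lra; ring.
Qed.

(** * Indefinite integrals *)

Lemma q_domain_iff (lam q : R) : 0 < lam -> (q_domain lam q <-> 0 < q /\ 1 < lam * q).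
Proof.
intros Hl; unfold q_domain, radicand; split; intros [H1 H2]; split; trivial.
- apply Rmult_lt_reg_r with q; lra.
- apply (Rmult_lt_compat_r q) in H2; lra.
Qed.

(** The domain is the half-line q > 1 / lam, so the integration path between two of its points stays
    inside. *)
Lemma q_domain_between (lam a b q : R) :
  0 < lam -> q_domain lam a -> q_domain lam b -> Rmin a b <= q <= Rmax a b ->
  q_domain lam q.
Proof.
intros Hl Ha Hb [Hq _]; apply q_domain_iff in Ha, Hb; trivial; apply q_domain_iff; trivial.
revert Hq; unfold Rmin; destruct (Rle_dec a b); intros Hq; split; nra.
Qed.

Lemma D_expl_sqrt (lam q v : R) : 0 < lam -> q_domain lam q -> D_expl lam (sqrt q) v.
Proof.
intros Hl Hq; apply q_domain_iff in Hq; trivial; destruct Hq as [Hq Hlq].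
apply D_expl_iff; trivial; rewrite <- sqrt_mult, <- sqrt_1 by lra.
apply sqrt_lt_1; lra.
Qed.

Lemma D_expl_q_domain (lam r v : R) :
  0 < lam -> (D_expl lam r v <-> 0 < r /\ q_domain lam (r ^ 2)).
Proof.
intros Hl; split.
- intros H; pose proof (D_expl_pos lam r v Hl H); pose proof (radicand_pos lam r v Hl H).
  split; trivial; apply q_domain_iff; trivial; split; nra.
- intros [Hr Hq]; rewrite <- (sqrt_pow2 r) by lra; apply D_expl_sqrt; trivial.
Qed.

Lemma sqrt_radicand (lam q : R) :
  0 < lam -> q_domain lam q -> sqrt (radicand lam q) = sqrt q * speed lam (sqrt q).
Proof.
intros Hl Hq; apply q_domain_iff in Hq; trivial.
unfold speed; rewrite <- sqrt_mult_alt, pow2_sqrt by lra.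
f_equal; unfold radicand; ring.
Qed.

Lemma is_derive_comp_sqrt (h : R -> R) (q l : R) :
  0 < q -> is_derive h (sqrt q) l ->
  is_derive (fun t => h (sqrt t)) q (l * / (2 * sqrt q)).
Proof.
intros Hq H; auto_derive; [split; [eexists; exact H | split; trivial]|].
change (fun x : R => h x) with h; rewrite (is_derive_unique _ _ _ H); ring.
Qed.

Lemma is_derive_x_expl_sqrt (lam q : R) :
  0 < lam -> q_domain lam q ->
  is_derive (fun t => x_expl lam (sqrt t)) q (1 / 2 * (1 / sqrt (radicand lam q))).
Proof.
intros Hl Hq; pose proof (D_expl_sqrt lam q 0 Hl Hq) as HD.
pose proof (speed_pos lam _ 0 Hl HD); pose proof (sqrt_lt_R0 q (proj1 Hq)).
rewrite (sqrt_radicand lam q Hl Hq).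
replace (1 / 2 * _) with (/ speed lam (sqrt q) * / (2 * sqrt q)) by (field; lra).
apply is_derive_comp_sqrt; [apply Hq | apply (is_derive_x_expl lam _ 0 Hl HD)].
Qed.

Lemma is_derive_m_expl_sqrt (lam q : R) :
  0 < lam -> q_domain lam q ->
  is_derive (fun t => m_expl lam (sqrt t)) q (1 / 2 * (q / sqrt (radicand lam q))).
Proof.
intros Hl Hq; pose proof (D_expl_sqrt lam q 0 Hl Hq) as HD.
pose proof (speed_pos lam _ 0 Hl HD); pose proof (sqrt_lt_R0 q (proj1 Hq)).
rewrite (sqrt_radicand lam q Hl Hq).
replace (1 / 2 * _) with (sqrt q ^ 2 / speed lam (sqrt q) * / (2 * sqrt q))
  by (rewrite pow2_sqrt by apply Rlt_le, Hq; field; lra).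
apply is_derive_comp_sqrt; [apply Hq | apply (is_derive_m_expl lam _ 0 Hl HD)].
Qed.

Lemma indefinite_integral_primitive (f : R -> R) (J : R -> Prop) (F : R -> R) (c : R) :
  (forall a b q, J a -> J b -> Rmin a b <= q <= Rmax a b -> J q) ->
  (forall q, J q -> is_derive F q (f q)) -> (forall q, J q -> continuous f q) ->
  indefinite_integral f J (fun q => c + F q).
Proof.
intros HJ HF Hf a b Ha Hb.
replace (c + F b - (c + F a)) with (minus (F b) (F a))
  by (unfold minus, plus, opp; simpl; ring).
apply (is_RInt_derive (V := R_CompleteNormedModule)); intros q Hq.
- apply HF, (HJ a b); trivial.
- apply Hf, (HJ a b); trivial.
Qed.

Lemma indefinite_integral_unique (f : R -> R) (J : R -> Prop) (F G : R -> R) (a b : R) :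
  indefinite_integral f J F -> indefinite_integral f J G -> J a -> J b ->
  F b = F a - G a + G b.
Proof.
intros HF HG Ha Hb.
pose proof (is_RInt_unique _ _ _ _ (HF a b Ha Hb)) as E1.
pose proof (is_RInt_unique _ _ _ _ (HG a b Ha Hb)) as E2; simpl in *; lra.
Qed.

Lemma indefinite_integral_x_expl (lam c : R) :
  0 < lam -> indefinite_integral (fun u => 1 / 2 * (1 / sqrt (radicand lam u)))
    (q_domain lam) (fun q => c + x_expl lam (sqrt q)).
Proof.
intros Hl; apply (indefinite_integral_primitive _ _ (fun q => x_expl lam (sqrt q))).
- intros a b q; apply q_domain_between, Hl.
- intros q; apply is_derive_x_expl_sqrt, Hl.
- intros q Hq; pose proof (sqrt_lt_R0 _ (proj2 Hq)); destruct Hq as [_ Hq].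
  apply (ex_derive_continuous (V := R_NormedModule)).
  unfold radicand in *; auto_derive.
  replace (lam * (q * (q * 1)) + - q) with (lam * q ^ 2 - q) by ring.
  repeat split; trivial; lra.
Qed.

Lemma indefinite_integral_m_expl (lam c : R) :
  0 < lam -> indefinite_integral (fun u => 1 / 2 * (u / sqrt (radicand lam u)))
    (q_domain lam) (fun q => c + m_expl lam (sqrt q)).
Proof.
intros Hl; apply (indefinite_integral_primitive _ _ (fun q => m_expl lam (sqrt q))).
- intros a b q; apply q_domain_between, Hl.
- intros q; apply is_derive_m_expl_sqrt, Hl.
- intros q Hq; pose proof (sqrt_lt_R0 _ (proj2 Hq)); destruct Hq as [_ Hq].
  apply (ex_derive_continuous (V := R_NormedModule)).
  unfold radicand in *; auto_derive.
  replace (lam * (q * (q * 1)) + - q) with (lam * q ^ 2 - q) by ring.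
  repeat split; trivial; lra.
Qed.

(** * Characterization *)

Lemma translated_expl_riemann (lam c1 c2 : R) (D : R -> R -> Prop) (X : R -> R -> pt) :
  0 < lam -> translated_expl lam c1 c2 D X -> riemann_ZMC_timelike D X.
Proof.
intros Hl H; split; [apply (translated_expl_regular lam c1 c2); trivial|].
split; [apply (translated_expl_ZMC lam c1 c2); trivial|].
destruct H as [HD HX]; split.
- intros Hrot; apply (not_rotational_expl lam Hl); revert Hrot.
  apply (rotational_trace_translate (c1, c2, c2)); intros p; split.
  + intros (r & v & Hrv & ->); exists r, v; split; [apply HD, Hrv|].
    rewrite (HX r v Hrv); apply pt_eq; unfold psub, padd, x1, x2, x3; simpl; ring.
  + intros (r & v & Hrv & E); apply HD in Hrv; exists r, v; split; trivial.
    rewrite (HX r v Hrv), <- E; apply pt_eq; unfold psub, padd, x1, x2, x3; simpl; ring.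
- exists (fun r => padd (c1, c2, c2) (x_expl lam r, m_expl lam r, m_expl lam r)), (fun r => r).
  split.
  + intros r v Hrv; split; [apply (D_expl_pos lam r v Hl), HD, Hrv|].
    exists v; rewrite (HX r v Hrv); unfold X_expl, circle_pt.
    apply pt_eq; unfold padd, pscal, x1, x2, x3; simpl; ring.
  + exists (1 / sqrt lam + 1), 0, (1 / sqrt lam + 2), 0; rewrite !HD; unfold D_expl.
    repeat split; lra.
Qed.

Lemma translated_expl_corresponds (lam c1 c2 : R) (D : R -> R -> Prop) (X : R -> R -> pt) :
  0 < lam -> translated_expl lam c1 c2 D X -> corresponds_to_1_1 D X.
Proof.
intros Hl [HD HX].
exists lam, (fun q => c1 + x_expl lam (sqrt q)), (fun q => c2 + m_expl lam (sqrt q)).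
split; [apply indefinite_integral_x_expl, Hl|].
split; [apply indefinite_integral_m_expl, Hl|].
split.
- intros r v; rewrite HD; apply D_expl_q_domain, Hl.
- intros r v Hrv; rewrite (HX r v Hrv); unfold q_family, X_expl.
  rewrite sqrt_pow2 by (apply HD in Hrv; apply Rlt_le, (D_expl_pos lam r v Hl Hrv)).
  apply pt_eq; unfold padd, pscal, x1, x2, x3; simpl; ring.
Qed.

Lemma corresponds_translated_expl (D : R -> R -> Prop) (X : R -> R -> pt) :
  (exists r v, D r v) -> corresponds_to_1_1 D X ->
  exists lam c1 c2, 0 < lam /\ translated_expl lam c1 c2 D X.
Proof.
intros (r0 & v0 & H0) (lam & x & m & Hx & Hm & HD & HX).
apply HD in H0; destruct H0 as [_ Hq0]; set (q0 := r0 ^ 2) in *.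
assert (Hl : 0 < lam).
{ destruct Hq0 as [Hq Hr]; unfold radicand in Hr.
  destruct (Rlt_le_dec 0 lam); trivial; nra. }
(* The integration constants are read off at the base point q0. *)
exists lam, (x q0 - x_expl lam (sqrt q0)), (m q0 - m_expl lam (sqrt q0)).
split; [trivial | split].
- intros r v; rewrite HD; symmetry; apply D_expl_q_domain, Hl.
- intros r v Hrv; rewrite (HX r v Hrv); apply HD in Hrv; destruct Hrv as [Hr Hq].
  pose proof (indefinite_integral_unique _ _ _ _ _ _ Hx
                (indefinite_integral_x_expl lam 0 Hl) Hq0 Hq) as Ex.
  pose proof (indefinite_integral_unique _ _ _ _ _ _ Hm
                (indefinite_integral_m_expl lam 0 Hl) Hq0 Hq) as Em.
  unfold q_family, X_expl; rewrite Ex, Em, sqrt_pow2 by lra.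
  apply pt_eq; unfold padd, pscal, x1, x2, x3; simpl; ring.
Qed.

(** * Limit hyperbola *)

(** The form in which weak inequalities on the surface pass to its limit points. *)
Lemma nonneg_of_continuous (U : UniformSpace) (f : U -> R) (p : U) :
  continuous f p -> (forall eps : posreal, exists q, ball p eps q /\ 0 <= f q) -> 0 <= f p.
Proof.
intros Hc H; destruct (Rle_lt_dec 0 (f p)) as [|Hneg]; trivial; exfalso.
destruct (Hc (fun y => y < 0)) as [eps He]; [apply (open_lt 0), Hneg|].
destruct (H eps) as (q & Hq & Hfq); specialize (He q Hq); lra.
Qed.

Lemma is_derive_sec_center (lam x : R) :
  0 < lam -> is_derive (sec_center lam) x (sec_radius lam x ^ 2).
Proof.
intros Hl; pose proof (sqrt_lt_R0 lam Hl) as Hk.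
unfold sec_center, sec_radius; auto_derive; trivial.
pose proof (cosh2_sinh2 (sqrt lam * x)) as Hch.
set (c := cosh _) in *; set (s := sinh _) in *; set (k := sqrt lam) in *.
field_simplify; [|lra|lra]; replace (s ^ 2) with (c ^ 2 - 1) by lra; field; lra.
Qed.

Lemma is_derive_sec_radius (lam x : R) :
  0 < lam -> is_derive (sec_radius lam) x (sinh (sqrt lam * x)).
Proof.
intros Hl; pose proof (sqrt_lt_R0 lam Hl) as Hk.
unfold sec_radius; auto_derive; trivial; field; lra.
Qed.

Lemma continuous_x1 (p : pt) : continuous x1 p.
Proof.
destruct p as [[a b] c]; apply (continuous_comp fst fst); apply continuous_fst.
Qed.

Lemma continuous_x2 (p : pt) : continuous x2 p.
Proof.
destruct p as [[a b] c];
  apply (continuous_comp fst snd); [apply continuous_fst | apply continuous_snd].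
Qed.

Lemma continuous_x3 (p : pt) : continuous x3 p.
Proof. destruct p as [a c]; apply continuous_snd. Qed.

Lemma continuous_implicit (lam : R) (p : pt) :
  0 < lam -> continuous (implicit lam) p.
Proof.
intros Hl.
assert (HM : continuous (fun q => sec_center lam (x1 q)) p).
{ apply (continuous_comp x1 (sec_center lam)); [apply continuous_x1|].
  apply (ex_derive_continuous (V := R_NormedModule)); eexists.
  apply is_derive_sec_center, Hl. }
assert (HR : continuous (fun q => sec_radius lam (x1 q)) p).
{ apply (continuous_comp x1 (sec_radius lam)); [apply continuous_x1|].
  apply (ex_derive_continuous (V := R_NormedModule)); eexists.
  apply is_derive_sec_radius, Hl. }
pose proof (continuous_x2 p) as H2; pose proof (continuous_x3 p) as H3.
assert (Hminus : forall f g, continuous f p -> continuous g p ->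
  continuous (fun q => f q - g q) p) by (intros f g; apply (continuous_minus f g)).
assert (Hmult : forall f g, continuous f p -> continuous g p ->
  continuous (fun q => f q * g q) p) by (intros f g; apply (continuous_mult f g)).
apply (Hminus (fun q => (x2 q - x3 q) * (x2 q + x3 q - 2 * sec_center lam (x1 q)))).
- apply (Hmult (fun q => x2 q - x3 q)); [apply Hminus; trivial|].
  apply (Hminus (fun q => x2 q + x3 q)); [apply (continuous_plus x2 x3); trivial|].
  apply (Hmult (fun _ => 2)); [apply continuous_const | trivial].
- apply Hmult; [trivial|]; apply (Hmult _ (fun _ => 1)); [trivial | apply continuous_const].
Qed.

Lemma sec_radius_0 (lam : R) : sec_radius lam 0 = 1 / sqrt lam.
Proof. unfold sec_radius; rewrite Rmult_0_r, cosh_0; reflexivity. Qed.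

Lemma sec_center_0 (lam : R) : sec_center lam 0 = 0.
Proof. unfold sec_center; rewrite Rmult_0_r, sinh_0; unfold Rdiv; ring. Qed.

(** For the lower limit, the point of fixed parameter s moves continuously with the height down to
    0. For the upper limit, the equation and the weak inequalities are closed conditions. *)
Lemma converges_expl (lam : R) :
  0 < lam ->
  converges_as_x1_to_0 (trace (D_expl lam) (X_expl lam))
    (timelike_circle (0, 0, 0) (1 / sqrt lam)).
Proof.
intros Hl; pose proof (sqrt_lt_R0 lam Hl) as Hk; split.
- intros p (s & ->) eps.
  assert (HC : forall a, continuous (fun t => sec_center lam t + sec_radius lam t * a) 0).
  { intros a; apply (ex_derive_continuous (V := R_NormedModule)); auto_derive.
    repeat split; eexists; [apply is_derive_sec_center | apply is_derive_sec_radius]; trivial. }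
  destruct (filter_and _ _ (proj1 (filterlim_locally _ _) (HC (cosh s)) eps)
                           (proj1 (filterlim_locally _ _) (HC (sinh s)) eps)) as [d Hd].
  (* d controls the last two coordinates, eps the first, which is the height t itself. *)
  exists (Rmin d eps); split; [apply Rmin_pos; apply cond_pos|].
  intros t [Ht0 Ht].
  pose proof (Rmin_l d eps); pose proof (Rmin_r d eps).
  assert (HB : forall e, t < e -> ball 0 e t).
  { intros e He; unfold ball; simpl; unfold AbsRing_ball, abs, minus, plus, opp; simpl.
    rewrite Ropp_0, Rplus_0_r, Rabs_pos_eq; lra. }
  destruct (Hd t (HB d ltac:(lra))) as [H2 H3].
  exists (X_expl lam (sec_radius lam t) s); rewrite (X_expl_sec lam t s Hl Ht0).
  split; [|split; [reflexivity|]].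
  + exists (sec_radius lam t), s; split; [apply D_expl_sec_radius; trivial|].
    symmetry; apply X_expl_sec; trivial.
  + replace (circle_pt (0, 0, 0) (1 / sqrt lam) s) with
      ((0, sec_center lam 0 + sec_radius lam 0 * cosh s,
           sec_center lam 0 + sec_radius lam 0 * sinh s) : pt).
    * split; [split|]; [apply HB; lra | exact H2 | exact H3].
    * rewrite sec_center_0, sec_radius_0.
      apply pt_eq; unfold circle_pt, padd, pscal, x1, x2, x3; simpl; ring.
- intros p Hp.
  assert (HN : forall f : pt -> R, continuous f p ->
    (forall q, 0 < x1 q -> 0 < x2 q - x3 q -> implicit lam q = 0 -> 0 <= f q) -> 0 <= f p).
  { intros f Hf Hpos; apply nonneg_of_continuous; trivial; intros eps.
    destruct (Hp eps 1 Rlt_0_1) as (q & Hq & _ & Hb); exists q; split; trivial.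
    apply trace_expl_iff in Hq; trivial; apply Hpos; apply Hq. }
  assert (Hx : x1 p = 0).
  { apply Rle_antisym; [|apply (HN x1); [apply continuous_x1 | intros; lra]].
    apply le_epsilon; intros d Hd; rewrite Rplus_0_l.
    apply Rminus_le_0, (nonneg_of_continuous _ (fun q => d - x1 q) p).
    - apply (continuous_minus (fun _ => d) x1); [apply continuous_const | apply continuous_x1].
    - intros eps; destruct (Hp eps d Hd) as (q & _ & Hq & Hb); exists q; split; trivial; lra. }
  assert (Hxi : 0 <= x2 p - x3 p).
  { apply (HN (fun q => x2 q - x3 q)); [|intros; lra].
    apply (continuous_minus x2 x3); [apply continuous_x2 | apply continuous_x3]. }
  assert (HI : implicit lam p = 0).
  { apply Rle_antisym.
    - apply Ropp_le_cancel; rewrite Ropp_0; apply (HN (fun q => - implicit lam q)).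
      + apply (continuous_opp (implicit lam)), continuous_implicit, Hl.
      + intros q _ _ ->; lra.
    - apply (HN (implicit lam)); [apply continuous_implicit, Hl | intros q _ _ ->; lra]. }
  unfold implicit in HI; rewrite Hx, sec_center_0, sec_radius_0 in HI.
  assert (Hr : 0 < 1 / sqrt lam) by (apply Rdiv_lt_0_compat; lra).
  destruct (hyperbola_param (1 / sqrt lam) (x2 p - x3 p) (x2 p + x3 p)) as (s & E1 & E2);
    [trivial | | lra |].
  (* Only x2 - x3 >= 0 survives the limit; the value 0 is excluded because the product in the
     equation equals (1 / k)^2 > 0. *)
  { destruct Hxi as [Hxi | Hxi]; [trivial|]; rewrite <- Hxi in HI.
    pose proof (pow_lt _ 2 Hr); lra. }
  exists s; apply pt_eq; unfold circle_pt, padd, pscal, x1, x2, x3 in *; simpl; lra.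
Qed.

Theorem proposition5p5 :
  (forall (D : R -> R -> Prop) (X : R -> R -> pt),
     riemann_ZMC_timelike D X /\ corresponds_to_1_1 D X <->
     exists lam c1 c2 : R,
       0 < lam /\
       (forall r v, D r v <-> D_expl lam r v) /\
       (forall r v, D r v -> X r v = padd (c1, c2, c2) (X_expl lam r v))) /\
  (forall lam : R, 0 < lam ->
     (forall p, trace (D_expl lam) (X_expl lam) p -> 0 < x1 p) /\
     exists (p : pt) (rho : R),
       0 < rho /\ x1 p = 0 /\
       converges_as_x1_to_0 (trace (D_expl lam) (X_expl lam))
                            (timelike_circle p rho)).
Proof.
split.
- intros D X; split.
  + intros [HR HC]; apply corresponds_translated_expl; [apply HR | exact HC].
  + intros (lam & c1 & c2 & Hl & H); split.
    * apply (translated_expl_riemann lam c1 c2); trivial.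
    * apply (translated_expl_corresponds lam c1 c2); trivial.
- intros lam Hl; split.
  + intros p Hp; apply (trace_expl_iff lam p Hl), Hp.
  + exists (0, 0, 0), (1 / sqrt lam); pose proof (sqrt_lt_R0 lam Hl).
    split; [apply Rdiv_lt_0_compat; lra | split; [reflexivity | apply converges_expl, Hl]].
Qed.
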